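(* Let $N\ge1$ and let $\phi$ be a unital strictly positive functional on $\mathcal{T}_N(\mathcal{A}_S)$ belonging to the Szegő class. Then, as $|\sigma|\to\infty$ ($\sigma\in\mathbb{F}_N^+$), in the sense of coefficient-wise convergence of formal power series in the noncommuting variables $X_1,\ldots,X_N$, $$\varphi_\sigma\rightarrow 0\qquad\text{and}\qquad(\varphi_\sigma^\sharp)^{-1}\rightarrow\Theta_\phi .$$
   Context: Words: $\mathbb{F}_N^+$ is the free unital semigroup on generators $1,\ldots,N$, with empty word $\emptyset$, length $|\sigma|$, and the total order $\prec$ in which shorter words come first and words of equal length are ordered lexicographically. For $\sigma\neq\emptyset$, $\sigma-1$ denotes the predecessor of $\sigma$. Enumerating words increasingly identifies $(\mathbb{F}_N^+,\prec)$ with $\mathbb{N}_0=\{0,1,2,\ldots\}$. Algebra: $\mathcal{P}_{2N}$ is the algebra of complex polynomials in noncommuting $X_1,\ldots,X_{2N}$; $\mathcal{P}_N\subset\mathcal{P}_{2N}$ is the subalgebra generated by $X_1,\ldots,X_N$; for $\sigma=i_1\cdots i_k\in\mathbb{F}_N^+$, $X_\sigma=X_{i_1}\cdots X_{i_k}$. $\mathcal{J}$ is the conjugate-linear involutive anti-automorphism of $\mathcal{P}_{2N}$ with $\mathcal{J}(X_k)=X_{N+k}$, $\mathcal{J}(X_{N+k})=X_k$, $1\le k\le N$. Let $$\mathcal{A}_S=\{1-\mathcal{J}(X_k)X_k: 1\le k\le N\}\cup\{\mathcal{J}(X_k)X_l:1\le k,l\le N,\ k\ne l\},$$ and let $\mathcal{T}_N(\mathcal{A}_S)$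 be the quotient of $\mathcal{P}_{2N}$ by the two-sided ideal generated by $\mathcal{A}_S$, with quotient map $\pi$ and induced involution, also denoted $\mathcal{J}$. The elements $\pi(X_\sigma)$, $\sigma\in\mathbb{F}_N^+$, are linearly independent, so $\mathcal{P}_N$ is identified with $\pi(\mathcal{P}_N)$. A linear functional $\phi$ on $\mathcal{T}_N(\mathcal{A}_S)$ is strictly positive if $\phi(\mathcal{J}(P)P)>0$ for all nonzero $P\in\mathcal{P}_N$, and unital if $\phi(1)=1$. Put $s_{\sigma,\tau}=K_\phi(\sigma,\tau)=\phi(\mathcal{J}(X_\sigma)X_\tau)$. Parameters: for a kernel $[s_{k,j}]_{k,j\in\mathbb{N}_0}$ with all matrices $[s_{i,j}]_{0\le i,j\le n}$ positive definite, $\{\gamma_{k,j}\}_{0\le k<j}$ is the unique family of complex numbers with $|\gamma_{k,j}|<1$ such that, with $d_{k,j}=(1-|\gamma_{k,j}|^2)^{1/2}$, $s_{k,j}=s_{k,k}^{1/2}(U_{k,j})_{1,1}s_{j,j}^{1/2}$ for $k<j$, where $U_{j,j}=1$ and $U_{k,j}=R_{k,k+1}\cdots R_{k,j}(U_{k+1,j}\oplus1)$ has size $m=j-k+1$, and $R_{k,k+i}$ is the $m\times m$ identity with its $2\times2$ block in rows and columns $i,i+1$ replaced by $\begin{bmatrix}\gamma_{k,k+i}& d_{k,k+i}\\ d_{k,k+i}&-\overline{\gamma}_{k,k+i}\end{bmatrix}$. Applying this to $K_\phi$ via the identification of $\mathbb{F}_N^+$ with $\mathbb{N}_0$ gives parameters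 $\gamma_{\sigma,\tau}$, $\sigma\prec\tau$; set $\gamma_\sigma=\gamma_{\emptyset,\sigma}$ and $d_\sigma=(1-|\gamma_\sigma|^2)^{1/2}$ for $\sigma\ne\emptyset$, and $d_\emptyset=1$. Orthogonal polynomials: $\{\varphi_\sigma\}_{\sigma\in\mathbb{F}_N^+}\subset\mathcal{P}_N$ is the orthonormal family obtained by Gram–Schmidt from $\{X_\sigma\}$ (in the order $\prec$, with positive leading coefficients) for the inner product $\langle P,Q\rangle=\phi(\mathcal{J}(Q)P)$. With the companion polynomials $\varphi_\sigma^\sharp$ they satisfy (and are determined by) $\varphi_\emptyset=\varphi^\sharp_\emptyset=1$ and, for $k\in\{1,\ldots,N\}$, $\sigma\in\mathbb{F}_N^+$, $$\varphi_{k\sigma}=\tfrac1{d_{k\sigma}}\big(X_k\varphi_\sigma-\gamma_{k\sigma}\varphi^\sharp_{k\sigma-1}\big),\qquad \varphi^\sharp_{k\sigma}=\tfrac1{d_{k\sigma}}\big(-\overline{\gamma}_{k\sigma}X_k\varphi_\sigma+\varphi^\sharp_{k\sigma-1}\big).$$ $(\varphi_\sigma^\sharp)^{-1}$ is the inverse of $\varphi_\sigma^\sharp$ in the algebra of formal power series in the noncommuting variables $X_1,\ldots,X_N$ (its constant term is nonzero). Spectral factor: for a family $\mathcal{F}=\{\mathcal{F}_\sigma\}_{\sigma\in\mathbb{F}_N^+}$ with each $\mathcal{F}_\sigma$ equal to $\{0\}$ or $\mathbb{C}$, consider arrays $\Theta=[\Theta_{\sigma,\tau}]$ with $\Theta_{\sigma,\tau}\in\mathcal{F}_\sigma$,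 $\Theta_{\sigma,\tau}=0$ for $\sigma\prec\tau$, and columns $c_\tau(\Theta)=[\Theta_{\sigma,\tau}]_\sigma$ in the Hilbert space $\bigoplus_{\sigma\succeq\tau}\mathcal{F}_\sigma$. Such $\Theta$ is outer if for every $\rho$ the set $\{c_\tau(\Theta):\tau\succeq\rho\}$ is total in $\bigoplus_{\tau\succeq\rho}\mathcal{F}_\tau$. Put $K_\Theta(\sigma,\tau)=c_\sigma(\Theta)^*c_\tau(\Theta)$ and write $K_1\le K_2$ if $K_2-K_1$ is a positive semidefinite kernel. The spectral factor of $K_\phi$ is the unique outer array $\Theta$ with $K_\Theta\le K_\phi$, with $K_{\Theta'}\le K_\Theta$ for every outer $\Theta'$ (for any family $\mathcal{F}'$) satisfying $K_{\Theta'}\le K_\phi$, and normalized by $\Theta_{\sigma,\sigma}\ge0$ for all $\sigma$. The functional $\phi$ belongs to the Szegő class if $\Theta_{\sigma,\sigma}>0$ for all $\sigma$; equivalently $\prod_{\sigma\in\mathbb{F}_N^+}d_\sigma>0$. In this setting the array satisfies $\Theta_{\tau\alpha,\tau}=\Theta_{\alpha,\emptyset}$ for all words $\alpha,\tau$ and $\Theta_{\sigma,\tau}=0$ if $\sigma$ is not of the form $\tau\alpha$, and it is identified with the formal power series $\Theta_\phi=\sum_{\alpha\in\mathbb{F}_N^+}\Theta_{\alpha,\emptyset}X_\alpha$. *)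

(* Defs.v *)
From HB Require Import structures.
From mathcomp Require Import all_boot all_order all_algebra finmap.
From mathcomp Require Import generic_quotient ring_quotient complex.
From mathcomp Require Import all_classical all_reals.
From mathcomp Require Import ereal topology normedtype sequences.
(* The notations of monalg clash with those of MathComp-Analysis. *)
From mathcomp Require Import -(notations) monalg.

Set Implicit Arguments.
Unset Strict Implicit.
Unset Printing Implicit Defensive.

Import Order.TTheory GRing.Theory Num.Theory.
Import numFieldNormedType.Exports.

Local Open Scope classical_set_scope.
Local Open Scope ring_scope.
Local Open Scope quotient_scope.

(* The letter X_k, 1 <= k <= n, is the ordinal k - 1 of 'I_n. *)
Definition word (n : nat) := seq 'I_n.

HB.instance Definition _ n := Choice.on (word n).

Fact word_cat_unit n (v w : word n) : v ++ w = [::] -> v = [::] /\ w = [::].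
Proof. by case: v; case: w. Qed.

HB.instance Definition _ n := Choice_isMonomialDef.Build (word n)
  (@catA 'I_n) (@cat0s 'I_n) (@cats0 'I_n) (@word_cat_unit n).

Definition shortlex {n} : rel (word n) := fun v w =>
  (size v < size w)%N
  || (size v == size w) && ((v : seqlexi 'I_n) < (w : seqlexi 'I_n))%O.

Fixpoint words_of_size (n k : nat) : seq (word n) :=
  if k is k'.+1 then [seq i :: w | i <- enum 'I_n, w <- words_of_size n k']
  else [:: [::]].

Definition words_upto (n m : nat) : seq (word n) :=
  flatten [seq words_of_size n k | k <- iota 0 m.+1].

(* The order isomorphism of the words for shortlex with nat: see word_rankK,
   word_atK and shortlex_rank. *)
Definition word_rank {n} (w : word n) : nat := index w (words_upto n (size w)).

Definition word_at {n} (m : nat) : word n := nth [::] (words_upto n m) m.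

Definition word_pred {n} (w : word n) : word n := word_at (word_rank w).-1.

Definition word_infty {n} : set_system (word n) :=
  filter_from setT (fun m => [set w | (m <= size w)%N]).

#[global] Instance word_infty_filter n : Filter (@word_infty n).
Proof.
apply: filter_fromT_filter; first by exists 0%N.
move=> i j; exists (maxn i j) => w /=.
by rewrite geq_max => /andP[].
Qed.

Section WordEnumeration.
Variable n : nat.
Implicit Types v w : word n.

Lemma mem_words_of_size k w : (w \in words_of_size n k) = (size w == k).
Proof.
elim: k w => [|k IH] [|i w] //=.
- by apply/negbTE/allpairsP => -[[i v] [_ _]].
- rewrite eqSS -IH; apply/allpairsP/idP => [[[j v] [_ /= vk [_ ->]]]|wk] //.
  by exists (i, w); rewrite mem_enum.
Qed.

Lemma mem_words_upto m w : (w \in words_upto n m) = (size w <= m)%N.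
Proof.
apply/flatten_mapP/idP => [[k]|wm].
  by rewrite mem_iota add0n ltnS mem_words_of_size => /andP[_ km] /eqP ->.
by exists (size w); rewrite ?mem_words_of_size // mem_iota.
Qed.

Lemma shortlex_cons i v w : shortlex (i :: v) (i :: w) = shortlex v w.
Proof.
rewrite /shortlex /= ltnS eqSS.
by rewrite /Order.lt /= lexx /=.
Qed.

Lemma shortlex_trans : transitive (@shortlex n).
Proof.
move=> w v u /orP[vw|/andP[/eqP vw vw']] /orP[wu|/andP[/eqP wu wu']].
- by apply/orP; left; apply: ltn_trans wu.
- by apply/orP; left; rewrite -wu.
- by apply/orP; left; rewrite vw.
- by apply/orP; right; rewrite vw wu eqxx; apply: lt_trans wu'.
Qed.

Lemma shortlex_irr : irreflexive (@shortlex n).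
Proof. by move=> w; rewrite /shortlex ltnn eqxx ltxx. Qed.

Lemma pairwise_words_of_size k : pairwise shortlex (words_of_size n k).
Proof.
elim: k => //= k IH.
have : pairwise (fun i j : 'I_n => (i < j)%O) (enum 'I_n).
  rewrite -(pairwise_map val) val_enum_ord.
  by rewrite -sorted_pairwise ?iota_ltn_sorted //; apply: ltn_trans.
elim: (enum 'I_n) => //= i s IHs /andP[/allP si ps].
rewrite pairwise_cat IHs // andbT pairwise_map; apply/andP; split.
  apply/allrelP => _ v /mapP[w wk ->] /allpairsP[[j u] /= [js uk ->]].
  rewrite !mem_words_of_size in wk uk.
  rewrite /shortlex /= (eqP wk) (eqP uk) eqxx ltnn /=.
  by rewrite /Order.lt /=; have := si _ js; case: ltgtP.
apply: etrans IH; apply: eq_pairwise => v w; exact: shortlex_cons.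
Qed.

Lemma words_uptoS m :
  words_upto n m.+1 = words_upto n m ++ words_of_size n m.+1.
Proof.
by rewrite /words_upto -[in LHS](addn1 m.+1) iotaD map_cat flatten_cat /= cats0.
Qed.

Lemma pairwise_words_upto m : pairwise shortlex (words_upto n m).
Proof.
elim: m => [|m IH]; first by rewrite /words_upto.
rewrite words_uptoS pairwise_cat IH pairwise_words_of_size !andbT.
apply/allrelP => v w; rewrite mem_words_upto mem_words_of_size => vm /eqP wm.
by rewrite /shortlex wm ltnS vm.
Qed.

Lemma uniq_words_upto m : uniq (words_upto n m).
Proof. exact: pairwise_uniq shortlex_irr (pairwise_words_upto m). Qed.

Lemma words_uptoD m p : exists s, words_upto n (m + p) = words_upto n m ++ s.
Proof.
elim: p => [|p [s E]]; first by exists [::]; rewrite addn0 cats0.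
by exists (s ++ words_of_size n (m + p).+1); rewrite addnS words_uptoS E catA.
Qed.

Lemma word_rankE m w :
  (size w <= m)%N -> word_rank w = index w (words_upto n m).
Proof.
move=> /subnKC <-; have [s ->] := words_uptoD (size w) (m - size w).
by rewrite index_cat mem_words_upto leqnn.
Qed.

Lemma shortlex_rank v w : shortlex v w = (word_rank v < word_rank w)%N.
Proof.
set m := maxn (size v) (size w).
rewrite (@word_rankE m v) ?leq_maxl // (@word_rankE m w) ?leq_maxr //.
have vm : v \in words_upto n m by rewrite mem_words_upto leq_maxl.
have wm : w \in words_upto n m by rewrite mem_words_upto leq_maxr.
have /(sorted_ltn_index shortlex_trans) lt :
  sorted shortlex (words_upto n m).
  by rewrite (sorted_pairwise shortlex_trans) pairwise_words_upto.
case: ltngtP => [lti|lti|/index_inj E]; first exact: lt.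
- apply/negbTE/negP => vw; have wv := lt _ _ wm vm lti.
  by have := shortlex_trans vw wv; rewrite shortlex_irr.
- by rewrite E // shortlex_irr.
Qed.

Hypothesis n_gt0 : (0 < n)%N.

Lemma size_words_upto m : (m < size (words_upto n m))%N.
Proof.
elim: m => // m IH; rewrite words_uptoS size_cat.
have : nseq m.+1 (Ordinal n_gt0) \in words_of_size n m.+1.
  by rewrite mem_words_of_size size_nseq.
case: (words_of_size _ _) => //= w s _.
by rewrite addnS ltnS; apply: leq_trans IH (leq_addr _ _).
Qed.

Lemma word_atE p m : (p <= m)%N -> word_at p = nth [::] (words_upto n m) p.
Proof.
move=> /subnKC <-; have [s ->] := words_uptoD p (m - p).
by rewrite nth_cat size_words_upto.
Qed.

Lemma word_rankK : cancel word_rank (@word_at n).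
Proof.
move=> w; set m := maxn (word_rank w) (size w).
rewrite (@word_atE _ m) ?leq_maxl // (@word_rankE m) ?leq_maxr //.
by rewrite nth_index // mem_words_upto leq_maxr.
Qed.

Lemma word_atK : cancel (@word_at n) word_rank.
Proof.
move=> m; have sm : (size (@word_at n m) <= m)%N.
  by rewrite -mem_words_upto mem_nth // size_words_upto.
by rewrite (word_rankE sm) index_uniq ?uniq_words_upto // size_words_upto.
Qed.

End WordEnumeration.

Section IdealQuotient.
Variables (K : nzRingType) (A : lalgType K) (S : set A).

Definition gen_ideal : {pred A} := fun x =>
  `[< exists2 s : seq (A * A * A), (forall t, t \in s -> S t.1.2) &
        x = \sum_(t <- s) t.1.1 * t.1.2 * t.2 >].

Lemma gen_ideal0 : 0 \in gen_ideal.
Proof. by apply/asboolP; exists [::]; rewrite ?big_nil. Qed.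

Lemma gen_idealD x y :
  x \in gen_ideal -> y \in gen_ideal -> x + y \in gen_ideal.
Proof.
move=> /asboolP[s sS ->] /asboolP[t tS ->]; apply/asboolP; exists (s ++ t).
  by move=> u; rewrite mem_cat => /orP[/sS|/tS].
by rewrite big_cat.
Qed.

Lemma gen_idealMl a x : x \in gen_ideal -> a * x \in gen_ideal.
Proof.
move=> /asboolP[s sS ->]; apply/asboolP.
exists [seq (a * t.1.1, t.1.2, t.2) | t <- s].
  by move=> _ /mapP[t /sS St ->].
by rewrite big_map mulr_sumr; apply: eq_bigr => t _; rewrite !mulrA.
Qed.

Lemma gen_idealMr a x : x \in gen_ideal -> x * a \in gen_ideal.
Proof.
move=> /asboolP[s sS ->]; apply/asboolP.
exists [seq (t.1.1, t.1.2, t.2 * a) | t <- s].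
  by move=> _ /mapP[t /sS St ->].
by rewrite big_map mulr_suml; apply: eq_bigr => t _; rewrite !mulrA.
Qed.

Lemma gen_idealZ c x : x \in gen_ideal -> c *: x \in gen_ideal.
Proof. by move=> xI; rewrite -[x]mul1r scalerAl gen_idealMl. Qed.

Lemma gen_ideal_gen x : S x -> x \in gen_ideal.
Proof.
move=> Sx; apply/asboolP; exists [:: (1, x, 1)].
  by move=> t; rewrite inE => /eqP ->.
by rewrite big_seq1 mul1r mulr1.
Qed.

Fact gen_ideal_zmod : zmod_closed gen_ideal.
Proof.
split=> [|x y xI yI]; first exact: gen_ideal0.
by rewrite gen_idealD // -mulN1r gen_idealMl.
Qed.

HB.instance Definition _ := GRing.isZmodClosed.Build A gen_ideal gen_ideal_zmod.

Definition ideal_quot := Quotient.quot gen_ideal.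

HB.instance Definition _ := GRing.Zmodule.on ideal_quot.

Definition qproj (x : A) : ideal_quot := \pi_ideal_quot x.

Lemma qprojP x y : reflect (qproj x = qproj y) (x - y \in gen_ideal).
Proof. by rewrite Quotient.idealrBE; apply: eqP. Qed.

Lemma qproj_surj (u : ideal_quot) : exists x, u = qproj x.
Proof. by exists (repr u); rewrite /qproj reprK. Qed.

Lemma repr_qproj x : repr (qproj x) - x \in gen_ideal.
Proof. by apply/qprojP; rewrite /qproj reprK. Qed.

Definition quot_one : ideal_quot := qproj 1.
Definition quot_mul (u v : ideal_quot) : ideal_quot := qproj (repr u * repr v).
Definition quot_scale (c : K) (u : ideal_quot) : ideal_quot :=
  qproj (c *: repr u).

Lemma qprojD x y : qproj (x + y) = qproj x + qproj y.
Proof. by rewrite /qproj !piE. Qed.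

Lemma quot_mulE x y : quot_mul (qproj x) (qproj y) = qproj (x * y).
Proof.
apply/qprojP; set x' := repr _; set y' := repr _.
have -> : x' * y' - x * y = x' * (y' - y) + (x' - x) * y.
  by rewrite mulrBr mulrBl addrA subrK.
by apply: gen_idealD; [apply: gen_idealMl | apply: gen_idealMr]; apply: repr_qproj.
Qed.

Lemma quot_scaleE c x : quot_scale c (qproj x) = qproj (c *: x).
Proof. by apply/qprojP; rewrite -scalerBr gen_idealZ ?repr_qproj. Qed.

Fact quot_mulA : associative quot_mul.
Proof.
move=> u v w; have [[x ->] [y ->] [z ->]] :=
  And3 (qproj_surj u) (qproj_surj v) (qproj_surj w).
by rewrite !quot_mulE mulrA.
Qed.

Fact quot_mul1 : left_id quot_one quot_mul.
Proof. by move=> u; have [x ->] := qproj_surj u; rewrite quot_mulE mul1r. Qed.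

Fact quot_1mul : right_id quot_one quot_mul.
Proof. by move=> u; have [x ->] := qproj_surj u; rewrite quot_mulE mulr1. Qed.

Fact quot_mulDl : left_distributive quot_mul +%R.
Proof.
move=> u v w; have [[x ->] [y ->] [z ->]] :=
  And3 (qproj_surj u) (qproj_surj v) (qproj_surj w).
by rewrite -qprojD !quot_mulE mulrDl qprojD.
Qed.

Fact quot_mulDr : right_distributive quot_mul +%R.
Proof.
move=> u v w; have [[x ->] [y ->] [z ->]] :=
  And3 (qproj_surj u) (qproj_surj v) (qproj_surj w).
by rewrite -qprojD !quot_mulE mulrDr qprojD.
Qed.

HB.instance Definition _ := GRing.Zmodule_isPzRing.Build ideal_quot
  quot_mulA quot_mul1 quot_1mul quot_mulDl quot_mulDr.

Fact quot_scaleA a b u :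
  quot_scale a (quot_scale b u) = quot_scale (a * b) u.
Proof. by have [x ->] := qproj_surj u; rewrite !quot_scaleE scalerA. Qed.

Fact quot_scale1 : left_id 1 quot_scale.
Proof. by move=> u; have [x ->] := qproj_surj u; rewrite quot_scaleE scale1r. Qed.

Fact quot_scaleDr : right_distributive quot_scale +%R.
Proof.
move=> c u v; have [x ->] := qproj_surj u; have [y ->] := qproj_surj v.
by rewrite -qprojD !quot_scaleE scalerDr qprojD.
Qed.

Fact quot_scaleDl u : {morph quot_scale^~ u : a b / a + b}.
Proof.
move=> a b; have [x ->] := qproj_surj u.
by rewrite !quot_scaleE scalerDl qprojD.
Qed.

HB.instance Definition _ := GRing.Zmodule_isLmodule.Build K ideal_quot
  quot_scaleA quot_scale1 quot_scaleDr quot_scaleDl.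

Fact qproj_linear : linear qproj.
Proof. by move=> c x y; rewrite qprojD -quot_scaleE. Qed.

HB.instance Definition _ := GRing.isLinear.Build K A ideal_quot *:%R qproj
  qproj_linear.

Fact qproj_monoid : monoid_morphism qproj.
Proof. by split=> // x y; rewrite -quot_mulE. Qed.

HB.instance Definition _ := GRing.isMonoidMorphism.Build A ideal_quot qproj
  qproj_monoid.

End IdealQuotient.

(* The monoid algebra of the free monoid, i.e. noncommutative polynomials. *)
Notation ncpoly R n := (@malg (word n) R[i]).

Section Toeplitz.
Variable R : realType.
Local Notation C := R[i].
Local Notation mono w := (@mkmalgU (word _) C w 1).

(* The additive map sending the term c X_w to f(c) X_{g(w)}. *)
Definition nc_map {m n} (f : C -> C) (g : word m -> word n) (p : ncpoly R m) :
    ncpoly R n :=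
  \sum_(w <- msupp p) mkmalgU (g w) (f (mcoeff w p)).

(* X_k <-> X_{N+k} *)
Definition flip {N} (k : 'I_(N + N)) : 'I_(N + N) :=
  match fintype.split k with inl i => rshift N i | inr i => lshift N i end.

Definition invol {N} : ncpoly R (N + N) -> ncpoly R (N + N) :=
  nc_map Num.conj (fun w => rev (map flip w)).

(* P_N as a subalgebra of P_{2N} *)
Definition nc_incl {N} : ncpoly R N -> ncpoly R (N + N) :=
  nc_map id (map (@lshift N N)).

Definition ncX {n} (k : 'I_n) : ncpoly R n := mono [:: k].

(* A_S, and its quotient T_N(A_S) below *)
Definition toep_rel N : set (ncpoly R (N + N)) :=
  [set p | (exists k : 'I_N,
              p = 1 - invol (ncX (lshift N k)) * ncX (lshift N k)) \/
           (exists k l : 'I_N,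
              k != l /\ p = invol (ncX (lshift N k)) * ncX (lshift N l))].

Definition toep N := ideal_quot (@toep_rel N).

Definition toep_proj {N} : ncpoly R (N + N) -> toep N := @qproj _ _ (@toep_rel N).

Lemma nc_map_coeff m n (f : C -> C) (g : word m -> word n) p w :
  f 0 = 0 -> injective g -> mcoeff (g w) (nc_map f g p) = f (mcoeff w p).
Proof.
move=> f0 g_inj; rewrite raddf_sum /=.
under eq_bigr do rewrite mcoeffU (inj_eq g_inj).
have [wp|wp] := boolP (w \in msupp p).
  rewrite (big_fsetD1 w) //= eqxx mulr1n big1_fset ?addr0 // => v.
  by rewrite in_fsetD1 => /andP[/negbTE ->].
rewrite (mcoeff_outdom wp) f0 big1_fset // => v vp _.
by case: eqP vp wp => // -> ->.
Qed.

Section InvolTheory.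
Variable N : nat.
Implicit Types (p q : ncpoly R (N + N)) (v w : word (N + N)).

Lemma flipK : involutive (@flip N).
Proof.
move=> k; rewrite /flip; case: (splitP k) => i ki.
  by rewrite (unsplitK (inr i)); apply: val_inj.
by rewrite (unsplitK (inl i)); apply: val_inj.
Qed.

Let rflip w : word (N + N) := rev (map flip w).

Let rflipK : involutive rflip.
Proof. by move=> w; rewrite /rflip map_rev revK mapK //; apply: flipK. Qed.

Lemma invol_coeff p w : mcoeff w (invol p) = (mcoeff (rflip w) p)^*.
Proof.
rewrite -{1}[w]rflipK /invol nc_map_coeff ?conjC0 //.
exact: can_inj rflipK.
Qed.

Lemma involK : involutive (@invol N).
Proof. by move=> p; apply/malgP => w; rewrite !invol_coeff conjCK rflipK. Qed.

Lemma involD p q : invol (p + q) = invol p + invol q.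
Proof.
by apply/malgP => w; rewrite mcoeffD !invol_coeff mcoeffD rmorphD.
Qed.

Lemma involB p q : invol (p - q) = invol p - invol q.
Proof.
by apply/malgP => w; rewrite mcoeffB !invol_coeff mcoeffB rmorphB.
Qed.

Lemma involZ c p : invol (c *: p) = c^* *: invol p.
Proof.
by apply/malgP => w; rewrite mcoeffZ !invol_coeff mcoeffZ rmorphM.
Qed.

Lemma invol_mono c w : invol (mkmalgU w c) = mkmalgU (rflip w) c^*.
Proof.
apply/malgP => v; rewrite invol_coeff !mcoeffU rmorphMn.
by rewrite -{1}[w]rflipK (inj_eq (can_inj rflipK)).
Qed.

Lemma invol1 : @invol N 1 = 1.
Proof. by rewrite [LHS]invol_mono conjC1. Qed.

Lemma involX (k : 'I_(N + N)) : invol (ncX k) = ncX (flip k).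
Proof. by rewrite invol_mono conjC1. Qed.

Lemma invol_sum (I : Type) (r : seq I) (F : I -> ncpoly R (N + N)) :
  invol (\sum_(i <- r) F i) = \sum_(i <- r) invol (F i).
Proof.
apply: (big_morph _ involD).
by apply/malgP => w; rewrite invol_coeff !mcoeff0 conjC0.
Qed.

Lemma involM p q : invol (p * q) = invol q * invol p.
Proof.
rewrite (monalgE p) (monalgE q) mulr_suml !invol_sum mulr_sumr.
apply: eq_bigr => v _; rewrite mulr_sumr invol_sum mulr_suml.
apply: eq_bigr => w _; rewrite !invol_mono malgM_def fgmulUU invol_mono.
by rewrite malgM_def fgmulUU /rflip map_cat rev_cat rmorphM mulrC.
Qed.

End InvolTheory.

Section ToeplitzInvolution.
Variable N : nat.
Implicit Types p q : ncpoly R (N + N).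

Lemma invol_rel p : toep_rel p -> toep_rel (invol p).
Proof.
case=> [[k ->]|[k [l [kl ->]]]]; [left; exists k|right; exists l, k].
  by rewrite involB invol1 involM involK.
by rewrite eq_sym involM involK.
Qed.

Lemma invol_ideal p :
  p \in gen_ideal (@toep_rel N) -> invol p \in gen_ideal (@toep_rel N).
Proof.
move=> /asboolP[s sS ->]; rewrite invol_sum; apply/asboolP.
exists [seq (invol t.2, invol t.1.2, invol t.1.1) | t <- s].
  by move=> _ /mapP[t /sS/invol_rel St ->].
by rewrite big_map; apply: eq_bigr => t _; rewrite !involM mulrA.
Qed.

Definition toep_invol (u : toep N) : toep N := toep_proj (invol (repr u)).

Lemma toep_involE p : toep_invol (toep_proj p) = toep_proj (invol p).
Proof.
apply/qprojP; rewrite -involB.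
exact/invol_ideal/repr_qproj.
Qed.

End ToeplitzInvolution.

(* The image in T_N(A_S) of a polynomial of P_N *)
Definition toep_poly {N} (p : ncpoly R N) : toep N := toep_proj (nc_incl p).

(* <P, Q> = phi(J(Q) P) *)
Definition inner {N} (phi : {scalar toep N}) (p q : ncpoly R N) : C :=
  phi (toep_invol (toep_poly q) * toep_poly p).

Definition strictly_positive {N} (phi : {scalar toep N}) : Prop :=
  forall p : ncpoly R N, p != 0 ->
    0 < phi (toep_invol (toep_poly p) * toep_poly p).

Definition moment_kernel {N} (phi : {scalar toep N}) (v w : word N) : C :=
  phi (toep_invol (toep_poly (mono v)) * toep_poly (mono w)).

Definition defect (g : C) : C := sqrtC (1 - `|g| ^+ 2).

(* The 2 x 2 block occupies the rows and columns of indices p and p + 1,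
   counted from 0. *)
Definition rotation (m p : nat) (g : C) : 'M[C]_m :=
  \matrix_(i, j)
    if (i == p :> nat) && (j == p :> nat) then g
    else if (i == p :> nat) && (j == p.+1 :> nat) then defect g
    else if (i == p.+1 :> nat) && (j == p :> nat) then defect g
    else if (i == p.+1 :> nat) && (j == p.+1 :> nat) then - g^*
    else (i == j)%:R.

(* U_(k, k + l) *)
Fixpoint schur_mx (gamma : nat -> nat -> C) (l k : nat) : 'M[C]_l.+1 :=
  if l is l'.+1 then
    (\prod_(p < l'.+1) rotation l'.+2 p (gamma k (k + p.+1)%N)) *
    castmx (addn1 l'.+1, addn1 l'.+1)
      (block_mx (schur_mx gamma l' k.+1) 0 0 (1%:M : 'M_1))
  else 1%:M.

(* Only the values gamma k j with k < j are relevant. *)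
Definition schur_params (s gamma : nat -> nat -> C) : Prop :=
  forall k j, (k < j)%N ->
    `|gamma k j| < 1 /\
    s k j = sqrtC (s k k) * schur_mx gamma (j - k) k ord0 ord0 * sqrtC (s j j).

Definition word_kernel {N} (K : word N -> word N -> C) (k j : nat) : C :=
  K (word_at k) (word_at j).

(* gamma_w = gamma_(emptyset, w) *)
Definition word_param {N} (gamma : nat -> nat -> C) (w : word N) : C :=
  gamma 0%N (word_rank w).

Record gram_schmidt {N} (phi : {scalar toep N}) (f : word N -> ncpoly R N) :
    Prop := {
  gram_schmidt_trig : forall v w, shortlex v w -> mcoeff w (f v) = 0;
  gram_schmidt_lead : forall v, 0 < mcoeff v (f v);
  gram_schmidt_orth : forall v w, inner phi (f v) (f w) = (v == w)%:R
}.

Definition companion {N} (gamma : nat -> nat -> C)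
    (f fs : word N -> ncpoly R N) : Prop :=
  fs [::] = 1 /\
  forall (k : 'I_N) (w : word N), let kw : word N := k :: w in
    let g := word_param gamma kw in
    fs kw = (defect g)^-1 *: (- g^* *: (ncX k * f w) + fs (word_pred kw)).

Definition ncseries n := word n -> C.

Definition ncseries_one {n} : ncseries n := fun w => (w == [::])%:R.

Definition ncseries_mul {n} (f g : ncseries n) : ncseries n := fun w =>
  \sum_(i < (size w).+1) f (take i w) * g (drop i w).

(* The zero series if f is not invertible *)
Definition ncseries_inv {n} (f : ncseries n) : ncseries n :=
  xget (fun=> 0) [set g | ncseries_mul f g = ncseries_one /\
                          ncseries_mul g f = ncseries_one].

Definition ncseries_of_poly {n} (p : ncpoly R n) : ncseries n :=
  fun w => mcoeff w p.

Definition coeffwise_cvg {n} (f : word n -> ncseries n) (g : ncseries n) :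
    Prop :=
  forall w, (f v w : C^o) @[v --> word_infty] --> (g w : C^o).

Definition sqnorm {N} (f : word N -> C) : \bar R :=
  (\sum_(0 <= n <oo) ((Normc.normc (f (word_at n)) ^+ 2)%:E))%E.

Definition array N := word N -> word N -> C.

Definition array_kernel {N} (Theta : array N) (v w : word N) : C :=
  limn (series (fun n => (Theta (word_at n) v)^* * Theta (word_at n) w : C^o)).

Definition psd_kernel {N} (K : word N -> word N -> C) : Prop :=
  forall (s : seq (word N)) (a : word N -> C), uniq s ->
    0 <= \sum_(v <- s) \sum_(w <- s) (a v)^* * K v w * a w.

Definition kernel_le {N} (K1 K2 : word N -> word N -> C) : Prop :=
  psd_kernel (fun v w => K2 v w - K1 v w).

(* F w holds when the space F_w is C, and fails when it is {0}. *)
Record outer {N} (F : pred (word N)) (Theta : array N) : Prop := {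
  outer_supp : forall v w, ~~ F v -> Theta v w = 0;
  outer_trig : forall v w, shortlex v w -> Theta v w = 0;
  outer_sqsum : forall w, (sqnorm (Theta^~ w) < +oo)%E;
  outer_total : forall (r : word N) (f : word N -> C),
    (sqnorm f < +oo)%E ->
    (forall v, ~~ F v || shortlex v r -> f v = 0) ->
    forall e : R, 0 < e ->
    exists (s : seq (word N)) (a : word N -> C),
      (forall w, w \in s -> ~~ shortlex w r) /\
      (sqnorm (fun v => f v - \sum_(w <- s) a w * Theta v w)%R < e%:E)%E
}.

Record spectral_factor {N} (K : word N -> word N -> C) (Theta : array N) :
    Prop := {
  spectral_factor_outer : exists F, outer F Theta;
  spectral_factor_le : kernel_le (array_kernel Theta) K;
  spectral_factor_max : forall F' Theta', outer F' Theta' ->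
    kernel_le (array_kernel Theta') K ->
    kernel_le (array_kernel Theta') (array_kernel Theta);
  spectral_factor_diag : forall w, 0 <= Theta w w
}.

Definition szego_class {N} (phi : {scalar toep N}) : Prop :=
  exists2 Theta, spectral_factor (moment_kernel phi) Theta &
    forall w, 0 < Theta w w.

(* The coefficients Theta_(w, emptyset) of the power series Theta_phi *)
Definition array_series {N} (Theta : array N) : ncseries N :=
  fun w => Theta w [::].

End Toeplitz.

(* Main.v *)
Require Import Defs.
From HB Require Import structures.
From mathcomp Require Import all_boot all_order all_algebra finmap.
From mathcomp Require Import complex.
From mathcomp Require Import all_classical all_reals.
From mathcomp Require Import ereal topology normedtype sequences.
From mathcomp Require Import -(notations) monalg.
From mathcomp Require Import ring.

(** Polynomials carry the inner product [<p, q> = phi (J(q) p)].  The relations of the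
    Toeplitz algebra say that left multiplications by the letters are isometries with
    pairwise orthogonal ranges ([inner_mulX]).

    Coefficients.  The array given by the Szego class is lower triangular with positive
    diagonal and its kernel is below the moment kernel, so the image of [p] is bounded
    by the norm of [p] and its coefficients can be recovered one after the other: every
    coefficient functional is bounded ([coef_bound]).  The orthonormal polynomials
    [f w] tend weakly to zero by Bessel's inequality, hence coefficientwise
    ([orthonormal_coef_cvg0]).

    Companions.  The Schur parameters of a Gram matrix are the inner products met by the
    Szego recursion ([szegoP]), so the companion of [w] is the normalised part of [1]
    orthogonal to the nonempty words up to [w] ([companion_szego]).  Its constant
    coefficient increases with [w] and is bounded, and the distance of two companions is
    controlled by the increment of these coefficients ([rgs_dist]): the companions form
    a Cauchy sequence, with limit a unit vector [omega] of the completion, and their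
    coefficients converge to a series [c] ([rgs_coef_cvg]).

    Spectral factor.  Let [Theta] be the spectral factor.  Pairing the words with
    [X_rho omega] is a row that vanishes after [rho], and by the Cauchy-Schwarz
    inequality its rank-one kernel is below the moment kernel.  A single row is an outer
    array, so maximality gives [Theta rho rho >= <1, omega>], and [<1, omega>] is the
    inverse of the constant coefficient of [c] ([spectral_diag_ge]).  On the other hand
    the linear map that sends [X_w] to the column [w] of [Theta] is a contraction.  The
    image of the unit vector [X_rho omega] has at [rho] the entry
    [c [::] * Theta rho rho >= 1], so it is the basis vector [rho]
    ([array_shift_mx]).  In coordinates this is an identity of lower triangular matrices
    indexed by words: [Theta] times the matrix of multiplication by [c] is the identity.
    The two factors then commute, and the first column of the other product reads
    [Theta_phi * c = 1] ([array_series_inverse]).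

    Finally inversion of power series is continuous for coefficientwise convergence
    ([ncseries_inv_cvg]), so the inverses of the companions converge to the inverse of
    [c], which is [Theta_phi]. *)

Set Implicit Arguments.
Unset Strict Implicit.
Unset Printing Implicit Defensive.

Import Order.TTheory GRing.Theory Num.Theory.
Import numFieldNormedType.Exports.
Local Open Scope classical_set_scope.
Local Open Scope ring_scope.

(** * Limits of complex sequences *)

Section ComplexLimits.
Variable R : realType.
Local Notation C := R[i].

Lemma normc_realE (x : R) : `|x%:C%C : C| = `|x|%:C%C.
Proof. by rewrite normc_def /= expr0n addr0 sqrtr_sqr. Qed.

Lemma normc_le_ReIm (z : C) : `|z| <= (`|complex.Re z| + `|complex.Im z|)%:C%C.
Proof.
rewrite {1}[z]complexE; apply: le_trans (ler_normD _ _) _.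
by rewrite rmorphD /= normrM complexiE normCi mul1r !normc_realE.
Qed.

Lemma normc_ge_Im (z : C) : `|complex.Im z|%:C%C <= `|z|.
Proof.
rewrite normc_def lecR -{1}sqrtr_sqr ler_wsqrtr //.
by rewrite lerDr sqr_ge0.
Qed.

(** Completeness and order-closedness of the complex field are inherited from the
    reals through this reduction. *)
Lemma cvg_complexP (T : Type) (F : set_system T) {FF : Filter F}
    (u : T -> C) (l : C) :
  ((u x : C^o) @[x --> F] --> (l : C^o)) <->
  ((complex.Re (u x) : R^o) @[x --> F] --> (complex.Re l : R^o)) /\
  ((complex.Im (u x) : R^o) @[x --> F] --> (complex.Im l : R^o)).
Proof.
split=> [|[/cvgrPdist_le uR /cvgrPdist_le uI]].
  move=> /cvgrPdist_le ul; split; apply/cvgrPdist_le => e e0.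
    apply: filterS (ul e%:C%C _) => [x|]; last by rewrite ltcR.
    move=> h; rewrite -lecR; apply: le_trans h.
    by rewrite -raddfB; exact: normc_ge_Re.
  apply: filterS (ul e%:C%C _) => [x|]; last by rewrite ltcR.
  move=> h; rewrite -lecR; apply: le_trans h.
  by rewrite -raddfB; exact: normc_ge_Im.
apply/cvgrPdist_le => e e0.
have eE : (complex.Re e)%:C%C = e by rewrite RRe_real // gtr0_real.
have e2 : 0 < complex.Re e / 2 by rewrite divr_gt0 // -ltcR eE.
near=> x; apply: le_trans (normc_le_ReIm _) _.
rewrite -eE lecR [leRHS]splitr !raddfB lerD //; near: x.
  exact: uR.
exact: uI.
Unshelve. all: end_near. Qed.

(** Cauchy's criterion in the form in which orthogonality delivers it: the square of
    a distance between projections is a difference of squared norms. *)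
Lemma cvg_of_sqdist_real (a r : nat -> R) (K M : R) :
  {homo r : n m / (n <= m)%N >-> n <= m} -> (forall n, r n <= M) -> 0 <= K ->
  (forall n m, (n <= m)%N -> (a n - a m) ^+ 2 <= K * (r m - r n)) ->
  cvgn (a : nat -> R^o).
Proof.
move=> r_nd rM K0 ar.
have K1 : 0 < K + 1 by rewrite ltr_wpDl.
have /cvgrPdist_lt rl : r @ \oo --> limn r.
  apply: nondecreasing_is_cvgn => //; exists M => _ [n _ <-]; exact: rM.
apply/cauchy_cvgP/cauchy_exP => e e0.
have d0 : 0 < e ^+ 2 / (K + 1) by rewrite divr_gt0 ?exprn_gt0.
have [n0 _ n0P] := rl _ (divr_gt0 d0 (ltr0Sn _ 1)).
exists (a n0); exists n0 => // n /= n0n.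
rewrite -ball_normE /= -(ltr_pXn2r (n:=2)) ?nnegrE ?(ltW e0) //.
rewrite real_normK ?num_real //.
apply: le_lt_trans (ar _ _ n0n) _.
apply: (@le_lt_trans _ _ ((K + 1) * (r n - r n0))).
  by rewrite ler_wpM2r ?lerDl ?ler01 // subr_ge0 r_nd.
rewrite mulrC -ltr_pdivlMr //.
rewrite [ltRHS]splitr.
have -> : r n - r n0 = (limn r - r n0) - (limn r - r n) by ring.
apply: le_lt_trans (ler_norm _) _.
apply: le_lt_trans (ler_normB _ _) _.
by apply: ltrD; apply: n0P => /=.
Qed.

Lemma cvg_of_sqdist (u : nat -> C) (r : nat -> R) (K M : R) :
  {homo r : n m / (n <= m)%N >-> n <= m} -> (forall n, r n <= M) -> 0 <= K ->
  (forall n m, (n <= m)%N -> `|u n - u m| ^+ 2 <= (K * (r m - r n))%:C%C) ->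
  exists l : C, (u n : C^o) @[n --> \oo] --> (l : C^o).
Proof.
move=> r_nd rM K0 ur.
have /(cvg_of_sqdist_real r_nd rM K0) cR n m : (n <= m)%N ->
    (complex.Re (u n) - complex.Re (u m)) ^+ 2 <= K * (r m - r n).
  move=> nm; rewrite -lecR; apply: le_trans (ur _ _ nm).
  by rewrite -add_Re2_Im2 lecR -raddfB lerDl sqr_ge0.
have /(cvg_of_sqdist_real r_nd rM K0) cI n m : (n <= m)%N ->
    (complex.Im (u n) - complex.Im (u m)) ^+ 2 <= K * (r m - r n).
  move=> nm; rewrite -lecR; apply: le_trans (ur _ _ nm).
  by rewrite -add_Re2_Im2 lecR -raddfB lerDr sqr_ge0.
exists (Complex (limn (fun n => complex.Re (u n) : R^o))
                (limn (fun n => complex.Im (u n) : R^o))).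
by apply/cvg_complexP; split.
Qed.

Lemma cvgc_ge (T : Type) (F : set_system T) {FF : ProperFilter F}
    (u : T -> C) (l a : C) :
  ((u x : C^o) @[x --> F] --> (l : C^o)) -> (\forall x \near F, a <= u x) ->
  a <= l.
Proof.
move=> /cvg_complexP[uR uI] au.
rewrite lecE; apply/andP; split.
  apply/eqP; apply: (cvg_unique (@norm_hausdorff R R^o) uI).
  apply: cvg_near_cst; near=> x.
  have: a <= u x by near: x.
  by rewrite lecE => /andP[/eqP].
apply: (@cvgr_to_ge _ _ _ _ _ _ _ uR).
near=> x.
have: a <= u x by near: x.
by rewrite lecE => /andP[].
Unshelve. all: end_near. Qed.

Lemma cvgc_le (T : Type) (F : set_system T) {FF : ProperFilter F}
    (u : T -> C) (l a : C) :
  ((u x : C^o) @[x --> F] --> (l : C^o)) -> (\forall x \near F, u x <= a) ->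
  l <= a.
Proof.
move=> ul ua; rewrite -lerN2; apply: (@cvgc_ge _ F FF (fun x => - u x)).
  exact: (@cvgN _ C^o _ _ _ _ _ ul).
by apply: filterS ua => x; rewrite lerN2.
Qed.

Lemma cvgc_conj (T : Type) (F : set_system T) {FF : Filter F}
    (u : T -> C) (l : C) :
  ((u x : C^o) @[x --> F] --> (l : C^o)) ->
  (((u x)^* : C^o) @[x --> F] --> (l^* : C^o)).
Proof.
move=> /cvgrPdist_le ul; apply/cvgrPdist_le => e /ul.
by apply: filterS => x; rewrite -rmorphB norm_conjC.
Qed.

Lemma cvgc_sum (T : Type) (F : set_system T) {FF : Filter F} (I : Type) (s : seq I)
    (P : pred I) (u : I -> T -> C) (l : I -> C) :
  (forall i, P i -> ((u i x : C^o) @[x --> F] --> (l i : C^o))) ->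
  ((\sum_(i <- s | P i) u i x : C^o) @[x --> F] --> (\sum_(i <- s | P i) l i : C^o)).
Proof.
move=> ul; elim: s => [|i s IH].
  under eq_fun do rewrite big_nil.
  rewrite big_nil; exact: (@cvg_cst C^o).
under eq_fun do rewrite big_cons.
rewrite big_cons; case: ifPn => Pi; last exact: IH.
exact: (@cvgD _ C^o _ _ _ _ _ _ _ (ul i Pi) IH).
Qed.

Lemma cvgc_mull (T : Type) (F : set_system T) {FF : Filter F}
    (u : T -> C) (l a : C) :
  ((u x : C^o) @[x --> F] --> (l : C^o)) ->
  ((a * u x : C^o) @[x --> F] --> (a * l : C^o)).
Proof. exact: (@cvgMl_tmp C). Qed.

Lemma cvgc_mulr (T : Type) (F : set_system T) {FF : Filter F}
    (u : T -> C) (l a : C) :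
  ((u x : C^o) @[x --> F] --> (l : C^o)) ->
  ((u x * a : C^o) @[x --> F] --> (l * a : C^o)).
Proof. exact: (@cvgMr_tmp C). Qed.

Lemma cvgcM (T : Type) (F : set_system T) {FF : Filter F}
    (u v : T -> C) (l m : C) :
  ((u x : C^o) @[x --> F] --> (l : C^o)) ->
  ((v x : C^o) @[x --> F] --> (m : C^o)) ->
  ((u x * v x : C^o) @[x --> F] --> (l * m : C^o)).
Proof. exact: (@cvgM C). Qed.

Lemma cvgcB (T : Type) (F : set_system T) {FF : Filter F}
    (u v : T -> C) (l m : C) :
  ((u x : C^o) @[x --> F] --> (l : C^o)) ->
  ((v x : C^o) @[x --> F] --> (m : C^o)) ->
  ((u x - v x : C^o) @[x --> F] --> (l - m : C^o)).
Proof. exact: (@cvgB _ C^o). Qed.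

Lemma cvgcV (T : Type) (F : set_system T) {FF : Filter F}
    (u : T -> C) (l : C) : l != 0 ->
  ((u x : C^o) @[x --> F] --> (l : C^o)) ->
  (((u x)^-1 : C^o) @[x --> F] --> (l^-1 : C^o)).
Proof. exact: (@cvgV C). Qed.

Lemma cvgc_norm (T : Type) (F : set_system T) {FF : Filter F}
    (u : T -> C) (l : C) :
  ((u x : C^o) @[x --> F] --> (l : C^o)) ->
  ((`|u x| : C^o) @[x --> F] --> (`|l| : C^o)).
Proof. exact: (@cvg_norm _ C^o). Qed.

Lemma cvgc_sqr_norm (T : Type) (F : set_system T) {FF : Filter F}
    (u : T -> C) (l : C) :
  ((u x : C^o) @[x --> F] --> (l : C^o)) ->
  ((`|u x| ^+ 2 : C^o) @[x --> F] --> (`|l| ^+ 2 : C^o)).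
Proof. by move=> /cvgc_norm ul; apply: cvgcM. Qed.

Lemma cvgc_unique (T : Type) (F : set_system T) {FF : ProperFilter F}
    (u : T -> C) (l m : C) :
  ((u x : C^o) @[x --> F] --> (l : C^o)) ->
  ((u x : C^o) @[x --> F] --> (m : C^o)) -> l = m.
Proof. exact: (cvg_unique (@norm_hausdorff C C^o)). Qed.

End ComplexLimits.

(** * Positive definite sesquilinear forms *)

Section PositiveForm.
Variables (C : numClosedFieldType) (V : lmodType C).

Record posdef_form (ip : V -> V -> C) : Prop := {
  pformDl : forall p q r, ip (p + q) r = ip p r + ip q r;
  pformDr : forall p q r, ip r (p + q) = ip r p + ip r q;
  pformZl : forall c p r, ip (c *: p) r = c * ip p r;
  pformZr : forall c p r, ip r (c *: p) = c^* * ip r p;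
  pform_gt0 : forall p, p != 0 -> 0 < ip p p
}.

Variables (ip : V -> V -> C) (ipP : posdef_form ip).
Local Notation "'<<' p ',' q '>>'" := (ip p q).

Lemma pform0l r : <<0, r>> = 0.
Proof. by rewrite -(scale0r (0 : V)) (pformZl ipP) mul0r. Qed.

Lemma pform0r r : <<r, 0>> = 0.
Proof. by rewrite -(scale0r (0 : V)) (pformZr ipP) conjC0 mul0r. Qed.

Lemma pformNl p r : <<- p, r>> = - <<p, r>>.
Proof. by rewrite -scaleN1r (pformZl ipP) mulN1r. Qed.

Lemma pformNr p r : <<r, - p>> = - <<r, p>>.
Proof. by rewrite -scaleN1r (pformZr ipP) rmorphN rmorph1 mulN1r. Qed.

Lemma pformBl p q r : <<p - q, r>> = <<p, r>> - <<q, r>>.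
Proof. by rewrite (pformDl ipP) pformNl. Qed.

Lemma pformBr p q r : <<r, p - q>> = <<r, p>> - <<r, q>>.
Proof. by rewrite (pformDr ipP) pformNr. Qed.

Lemma pform_suml (I : Type) (s : seq I) (P : pred I) (F : I -> V) r :
  <<\sum_(i <- s | P i) F i, r>> = \sum_(i <- s | P i) <<F i, r>>.
Proof.
exact: (big_morph (fun p => <<p, r>>) (fun p q => pformDl ipP p q r) (pform0l r)).
Qed.

Lemma pform_sumr (I : Type) (s : seq I) (P : pred I) (F : I -> V) r :
  <<r, \sum_(i <- s | P i) F i>> = \sum_(i <- s | P i) <<r, F i>>.
Proof.
exact: (big_morph (fun p => <<r, p>>) (fun p q => pformDr ipP p q r) (pform0r r)).
Qed.

Lemma pform_ge0 p : 0 <= <<p, p>>.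
Proof.
by have [->|p0] := eqVneq p 0; rewrite ?pform0l // ltW // (pform_gt0 ipP).
Qed.

Lemma pform_eq0 p : <<p, p>> = 0 -> p = 0.
Proof.
move=> pp; have [//|p0] := eqVneq p 0.
by have := pform_gt0 ipP p0; rewrite pp ltxx.
Qed.

(** Polarisation: since the diagonal values are real, comparing the values at
    [p + q] and at [p + i q] forces hermitian symmetry. *)
Lemma pform_conj p q : <<q, p>> = (<<p, q>>)^*.
Proof.
have real r : (<<r, r>>)^* = <<r, r>> by apply/CrealP/ger0_real/pform_ge0.
have := real (p + q); have := real (p + 'i *: q).
rewrite !(pformDl ipP, pformDr ipP, pformZl ipP, pformZr ipP).
rewrite !(rmorphD, rmorphM, rmorphN) /= !real !(conjCi, rmorphN, opprK) /=.
set x := <<p, q>>; set y := <<q, p>>; set P := <<p, p>>; set Q := <<q, q>>.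
move=> E1 E2.
have i0 : ('i : C) != 0 by rewrite neq0Ci.
rewrite !conjCi !opprK in E1.
have E3 : x^* + y^* = x + y.
  apply: (addrI (P + Q)); transitivity (P + x^* + (y^* + Q)); first ring.
  by rewrite E2; ring.
have E4 : x^* - y^* = y - x.
  apply: (mulfI i0); apply: (addrI (P - 'i * 'i * Q)).
  transitivity (P + 'i * x^* + (- 'i * y^* + - 'i * ('i * Q))); first ring.
  by rewrite E1; ring.
have : 2 * y = 2 * x^*.
  transitivity ((x + y) + (y - x)); first ring.
  by rewrite -E3 -E4; ring.
by apply: mulfI; rewrite pnatr_eq0.
Qed.

Lemma cauchy_schwarz p q : `|<<p, q>>| ^+ 2 <= <<p, p>> * <<q, q>>.
Proof.
have [->|q0] := eqVneq q 0; first by rewrite !pform0r normr0 expr0n mulr0.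
have qq : 0 < <<q, q>> by exact: pform_gt0.
have := pform_ge0 (<<q, q>> *: p - <<p, q>> *: q).
rewrite !(pformBl, pformBr, pformZl ipP, pformZr ipP) (pform_conj p q).
rewrite (CrealP (gtr0_real qq)).
set x := <<p, q>>; set Q := <<q, q>>; set P := <<p, p>>.
rewrite [X in 0 <= X](_ : _ = Q * (P * Q - x * x^*)); last by ring.
by rewrite pmulr_rge0 // subr_ge0 normCK.
Qed.

End PositiveForm.

(** * The moment inner product on noncommutative polynomials *)

Section NCInclusion.
Variables (R : realType) (N : nat).
Local Notation C := R[i].
Implicit Types (p q : ncpoly R N) (u v w : word N).

Let lw : word N -> word (N + N) := map (@lshift N N).

(** As an instance of [mmap], the inclusion is additive. *)
Lemma nc_inclE p : nc_incl p =
  mmap (mkmalgU ([::] : word (N + N))) (fun w => mkmalgU (lw w) 1) p.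
Proof.
rewrite mmapE; apply: eq_bigr => w _.
by rewrite mul_malgC; apply/malgP => v; rewrite mcoeffZ !mcoeffU mulr_natr.
Qed.

Lemma nc_inclD p q : nc_incl (p + q) = nc_incl p + nc_incl q.
Proof. by rewrite !nc_inclE raddfD. Qed.

Lemma nc_incl_sum (I : Type) (r : seq I) (F : I -> ncpoly R N) :
  nc_incl (\sum_(i <- r) F i) = \sum_(i <- r) nc_incl (F i).
Proof.
apply: (big_morph _ nc_inclD).
by rewrite nc_inclE raddf0.
Qed.

Lemma nc_inclU w (c : C) : nc_incl (mkmalgU w c) = mkmalgU (lw w) c.
Proof.
rewrite nc_inclE mmapU mul_malgC.
by apply/malgP => v; rewrite mcoeffZ !mcoeffU mulr_natr.
Qed.

Lemma nc_inclZ c p : nc_incl (c *: p) = c *: nc_incl p.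
Proof.
rewrite (monalgE p) scaler_sumr !nc_incl_sum scaler_sumr.
have ZU n (v : word n) (b : C) : c *: mkmalgU v b = mkmalgU v (c * b).
  by apply/malgP => t; rewrite mcoeffZ !mcoeffU mulrnAr.
by apply: eq_bigr => w _; rewrite ZU !nc_inclU ZU.
Qed.

Lemma nc_inclM p q : nc_incl (p * q) = nc_incl p * nc_incl q.
Proof.
rewrite (monalgE p) (monalgE q) mulr_suml !nc_incl_sum mulr_suml.
apply: eq_bigr => v _; rewrite mulr_sumr nc_incl_sum mulr_sumr.
apply: eq_bigr => w _; rewrite malgM_def fgmulUU !nc_inclU.
by rewrite malgM_def fgmulUU /lw map_cat.
Qed.

Lemma nc_incl1 : nc_incl (1 : ncpoly R N) = 1.
Proof. exact: nc_inclU. Qed.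

Lemma nc_inclX k : nc_incl (ncX R k) = ncX R (lshift N k).
Proof. exact: nc_inclU. Qed.

(** The relations of the Toeplitz algebra in one formula: the letters are isometries
    with pairwise orthogonal ranges. *)
Lemma toep_rel_orth (k l : 'I_N) :
  @toep_proj R N (invol (ncX R (lshift N k)) * ncX R (lshift N l)) = (k == l)%:R.
Proof.
case: eqP => [<-|/eqP kl].
  by apply/esym/qprojP/gen_ideal_gen; left; exists k.
rewrite -[RHS](rmorph0 (@toep_proj R N)); apply/qprojP.
by rewrite subr0; apply: gen_ideal_gen; right; exists k, l.
Qed.

End NCInclusion.

(* Otherwise unification unfolds the convolution product of the monoid algebra and
   the quotient when it compares two different products. *)
#[local] Opaque nc_incl invol ncX toep_proj qproj.

(** Proved over abstract rings, where unification has nothing to unfold. *)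
Lemma mulr_relE (A : nzRingType) (B : pzRingType) (h : A -> B)
    (hM : forall x y, h (x * y) = h x * h y) (a b x : A) (e : bool) :
  h x = e%:R -> h (a * x * b) = if e then h (a * b) else 0.
Proof.
by move=> hx; rewrite !hM hx; case: e {hx}; rewrite ?hM ?mulr1 // mulr0 mul0r.
Qed.

Lemma mulr_regroup (A : nzRingType) (u v a b x y : A) :
  u = a * x -> v = y * b -> u * v = a * (x * y) * b.
Proof. by move=> -> ->; rewrite !mulrA. Qed.

Section InnerProduct.
Variables (R : realType) (N : nat) (phi : {scalar toep R N}).
Local Notation C := R[i].
Implicit Types (p q r : ncpoly R N) (u v w : word N) (c : C).
Local Notation "'<<' p ',' q '>>'" := (inner phi p q).

Lemma innerE p q : <<p, q>> = phi (toep_proj (invol (nc_incl q) * nc_incl p)).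
Proof. by rewrite /inner /toep_poly toep_involE -rmorphM. Qed.

Lemma phi_projD (p q : ncpoly R (N + N)) :
  phi (toep_proj (p + q)) = phi (toep_proj p) + phi (toep_proj q).
Proof.
by rewrite -raddfD -[_ + _ in RHS](raddfD (@qproj _ _ (@toep_rel R N))).
Qed.

Lemma phi_projZ c (p : ncpoly R (N + N)) :
  phi (toep_proj (c *: p)) = c * phi (toep_proj p).
Proof.
exact: (etrans (congr1 phi (esym (quot_scaleE _ c p))) (linearZ _ _)).
Qed.

(** Scalars act on the left factor of a product by definition of the algebra; the
    involution exchanges the two factors. *)
Lemma ncpoly_scalerAr c (p q : ncpoly R (N + N)) : p * (c *: q) = c *: (p * q).
Proof.
apply: (can_inj (@involK R N)).
by rewrite involM [in LHS]involZ [RHS]involZ involM scalerAl.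
Qed.

Lemma toep_projM (p q : ncpoly R (N + N)) :
  toep_proj (p * q) = toep_proj p * toep_proj q.
Proof. exact: (rmorphM (@qproj _ _ (@toep_rel R N))). Qed.

Lemma toep_proj_relM (k l : 'I_N) (a b : ncpoly R (N + N)) :
  toep_proj (a * (invol (ncX R (lshift N k)) * ncX R (lshift N l)) * b) =
  if k == l then toep_proj (a * b) else 0.
Proof. exact: (mulr_relE toep_projM _ _ (toep_rel_orth R k l)). Qed.

Lemma nc_incl_mulX k l p q :
  invol (nc_incl (ncX R l * q)) * nc_incl (ncX R k * p) =
  invol (nc_incl q) * (invol (ncX R (lshift N l)) * ncX R (lshift N k)) *
    nc_incl p.
Proof.
have E (j : 'I_N) (r : ncpoly R N) :
    nc_incl (ncX R j * r) = ncX R (lshift N j) * nc_incl r.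
  by rewrite -nc_inclX; exact: nc_inclM.
have E' : invol (nc_incl (ncX R l * q)) =
    invol (nc_incl q) * invol (ncX R (lshift N l)).
  by rewrite (E l q); exact: involM.
exact: (mulr_regroup E' (E k p)).
Qed.

(** The shift invariance of the moment kernel enters the proof only through this
    identity. *)
Lemma inner_mulX k l p q :
  <<ncX R k * p, ncX R l * q>> = if k == l then <<p, q>> else 0.
Proof.
apply: (etrans (innerE _ _)).
apply: (etrans (congr1 (fun x => phi (toep_proj x)) (nc_incl_mulX _ _ _ _))).
apply: (etrans (congr1 phi (toep_proj_relM _ _ _ _))).
rewrite [l == k]eq_sym; case: (k == l); last exact: linear0.
by apply: esym; apply: innerE.
Qed.

#[local] Opaque inner.

Lemma innerDl p q r : <<p + q, r>> = <<p, r>> + <<q, r>>.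
Proof. by rewrite !innerE nc_inclD mulrDr phi_projD. Qed.

Lemma innerDr p q r : <<r, p + q>> = <<r, p>> + <<r, q>>.
Proof. by rewrite !innerE nc_inclD involD mulrDl phi_projD. Qed.

Lemma innerZl c p r : <<c *: p, r>> = c * <<p, r>>.
Proof. by rewrite !innerE nc_inclZ ncpoly_scalerAr phi_projZ. Qed.

Lemma innerZr c p r : <<r, c *: p>> = c^* * <<r, p>>.
Proof. by rewrite !innerE nc_inclZ involZ -scalerAl phi_projZ. Qed.


Lemma inner_form : strictly_positive phi -> posdef_form (inner phi).
Proof.
by move=> phi_pos; split; [exact: innerDl | exact: innerDr | exact: innerZl
  | exact: innerZr | exact: phi_pos].
Qed.

Local Notation mono w := (@mkmalgU (word N) C w 1).

Lemma ncX_mono k w : ncX R k * mono w = mono (k :: w).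
Proof. by rewrite malgM_def; apply: (etrans (fgmulUU _ _ _ _)); rewrite mulr1. Qed.

Lemma inner_mono v w : inner phi (mono w) (mono v) = moment_kernel phi v w.
Proof. by []. Qed.

Lemma inner_mono1 w : phi 1 = 1 -> inner phi (mono w) (mono w) = 1.
Proof.
move=> phi1; elim: w => [|k w IH].
  have e1 : nc_incl (mono ([::] : word N)) = 1 := nc_incl1 R N.
  have e2 : invol (nc_incl (mono ([::] : word N))) * nc_incl (mono ([::] : word N)) = 1.
    by rewrite e1 (invol1 R N) mul1r.
  exact: (etrans (innerE _ _) (etrans (congr1 (fun x => phi (toep_proj x)) e2) phi1)).
by rewrite -ncX_mono inner_mulX eqxx.
Qed.

End InnerProduct.

(** * Schur parameters and the Szego recursion *)

Section SzegoRecursion.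
Variables (R : realType) (V : lmodType R[i]).
Local Notation C := R[i].
Variables (x : nat -> V) (gamma : nat -> nat -> C).

(** For [x] with Gram matrix of Schur parameters [gamma], the first component is the
    normalised part of [x (k + l)] orthogonal to [x k, ..., x (k + l).-1], and the
    second one is the normalised part of [x k] orthogonal to the later vectors.  They
    are defined by the recursion, so that the identities with the matrices of the
    parametrisation are purely algebraic; their geometric meaning is [szegoP]. *)
Fixpoint szego (l k : nat) : V * V :=
  if l is l'.+1 then
    let F := (szego l' k.+1).1 in let G := (szego l' k).2 in
    let g := gamma k (k + l'.+1)%N in
    ((defect g)^-1 *: (F - g *: G), (defect g)^-1 *: (- g^* *: F + G))
  else (x k, x k).

Local Notation F l k := (szego l k).1.
Local Notation G l k := (szego l k).2.

Lemma defect_gt0 (g : C) : `|g| < 1 -> 0 < defect g.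
Proof. by move=> g1; rewrite sqrtC_gt0 subr_gt0 expr_lt1. Qed.

Lemma sqr_defect (g : C) : defect g ^+ 2 = 1 - g * g^*.
Proof. by rewrite sqrtCK normCK. Qed.

Lemma sum_rotation m p (g : C) (e : nat -> V) (j : 'I_m) : (p.+1 < m)%N ->
  \sum_(i < m) rotation m p g i j *: e i =
  if j == p :> nat then g *: e p + defect g *: e p.+1
  else if j == p.+1 :> nat then defect g *: e p - g^* *: e p.+1 else e j.
Proof.
move=> pm; have pm' := ltnW pm.
rewrite (bigD1 (Ordinal pm')) //= (bigD1 (Ordinal pm)) /=; last first.
  by rewrite -val_eqE /= neq_ltn ltnSn orbT.
rewrite !mxE /= !eqxx /= !(gtn_eqF (ltnSn p)) !(ltn_eqF (ltnSn p)) /=.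
have rest : j != p :> nat -> j != p.+1 :> nat ->
    \sum_(i < m | (i != Ordinal pm') && (i != Ordinal pm))
      rotation m p g i j *: e i = e j.
  move=> jp jp1; rewrite (bigD1 j) /=; last by rewrite -!val_eqE /= jp.
  rewrite big1 ?addr0 => [|i /andP[/andP[ip ip1] ij]].
    by rewrite !mxE (negbTE jp) (negbTE jp1) eqxx scale1r.
  rewrite -!val_eqE /= in ip ip1 ij.
  by rewrite !mxE (negbTE ip) (negbTE ip1) -val_eqE (negbTE ij) scale0r.
have rest0 : (j == p :> nat) || (j == p.+1 :> nat) ->
    \sum_(i < m | (i != Ordinal pm') && (i != Ordinal pm))
      rotation m p g i j *: e i = 0.
  move=> jpp; rewrite big1 // => i /andP[ip ip1].
  rewrite -!val_eqE /= in ip ip1.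
  rewrite !mxE (negbTE ip) (negbTE ip1) /=.
  case: (i =P j) => [E|]; last by rewrite scale0r.
  by move: jpp; rewrite -E (negbTE ip) (negbTE ip1).
have [jp|jp] := eqVneq (j : nat) p.
  by rewrite rest0 ?jp ?eqxx // addr0.
have [jp1|jp1] := eqVneq (j : nat) p.+1.
  by rewrite rest0 ?jp1 ?eqxx ?orbT // addr0 scaleNr.
rewrite rest // -!val_eqE /= ![p == _]eq_sym ![p.+1 == _]eq_sym.
rewrite (negbTE jp) (negbTE jp1).
by rewrite !scale0r !add0r.
Qed.

Hypothesis gamma_lt1 : forall k j, (k < j)%N -> `|gamma k j| < 1.

Let gk_lt1 k m : `|gamma k (k + m.+1)%N| < 1.
Proof. by apply: gamma_lt1; rewrite addnS ltnS leq_addr. Qed.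

(** A rotation block takes the pair [G m k, F m.+1 k] to [F m k.+1, G m.+1 k]; this
    identity is its first column and [szego_rot2] its second one. *)
Lemma szego_rot1 m k (g := gamma k (k + m.+1)%N) :
  g *: G m k + defect g *: F m.+1 k = F m k.+1.
Proof.
rewrite /= -/g scalerA divff ?gt_eqF ?defect_gt0 ?gk_lt1 // scale1r.
by rewrite addrC subrK.
Qed.

Lemma szego_rot2 m k (g := gamma k (k + m.+1)%N) :
  defect g *: G m k - g^* *: F m.+1 k = G m.+1 k.
Proof.
have d0 : defect g != 0 by rewrite gt_eqF ?defect_gt0 ?gk_lt1.
have -> : G m.+1 k = (defect g)^-1 *: (- g^* *: F m k.+1 + G m k) by [].
rewrite -(szego_rot1 m k) -/g; apply: (scalerI d0).
rewrite [RHS]scalerA divff // scale1r scalerBr scalerDr !scalerA -expr2 sqr_defect.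
rewrite scalerBl scale1r !mulNr !scaleNr [g^* * g]mulrC [g^* * _]mulrC.
by rewrite [RHS]addrC addrA.
Qed.

(* The family reached from [F 0 k, F 1 k, ...] after [m] rotations. *)
Let E k m i := if (i < m)%N then F i k.+1 else if i == m then G m k else F i k.

Let E0 k i : E k 0 i = F i k.
Proof. by rewrite /E; case: i. Qed.

Let mulr_mxE n (A B : 'M[C]_n.+1) i j : (A * B) i j = \sum_t A i t * B t j.
Proof. by rewrite [A * B]/(A *m B) mxE. Qed.

Lemma sum_rotation_prod l k m (j : 'I_l.+2) : (m < l.+2)%N ->
  \sum_(i < l.+2)
    (\prod_(p < m) rotation l.+2 p (gamma k (k + p.+1)%N)) i j *: F i k = E k m j.
Proof.
elim: m j => [|m IH] j mn.
  rewrite big_ord0 (bigD1 j) //= big1 => [|i ij].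
    by rewrite mxE eqxx scale1r addr0 E0.
  by rewrite mxE (negbTE ij) scale0r.
under eq_bigr do rewrite big_ord_recr mulr_mxE scaler_suml.
rewrite exchange_big /=.
transitivity (\sum_(t < l.+2) rotation l.+2 m (gamma k (k + m.+1)%N) t j *: E k m t).
  apply: eq_bigr => t _; rewrite -(IH t (ltnW mn)) scaler_sumr.
  by apply: eq_bigr => i _; rewrite scalerA mulrC.
rewrite sum_rotation // /E !ltnn !eqxx.
rewrite (ltnNge m.+1) leqnSn (gtn_eqF (ltnSn m)) /= -/(szego m.+1 k).
have [jm|jm] := eqVneq (j : nat) m.
  by rewrite jm ltnSn; exact: szego_rot1.
have [jm1|jm1] := eqVneq (j : nat) m.+1.
  by rewrite jm1 ltnn; exact: szego_rot2.
by rewrite ltnS [(j < m)%N in LHS]ltn_neqAle jm.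
Qed.

(** The first column of [U_(k, k + l)] lists the coordinates of [x (k + l)] in the
    family [F 0 k, ..., F l k].  No orthogonality is involved. *)
Lemma schur_mx_col l k :
  \sum_(i < l.+1) schur_mx gamma l k i ord0 *: F i k = x (k + l).
Proof.
elim: l k => [|l IH] k.
  by rewrite big_ord1 /= mxE eqxx scale1r addn0.
rewrite -[RHS]/(x (k + l.+1)%N) addnS -addSn -IH.
rewrite [schur_mx _ _ _]/=.
set P := \prod_(_ < _) _; set B := castmx _ _.
transitivity (\sum_(t < l.+2) B t ord0 *: E k l.+1 t).
  under eq_bigr do rewrite mulr_mxE scaler_suml.
  rewrite exchange_big /=; apply: eq_bigr => t _.
  rewrite -(sum_rotation_prod k t (ltnSn _)) scaler_sumr; apply: eq_bigr => i _.
  by rewrite scalerA mulrC.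
rewrite big_ord_recr /= {2}/B castmxE /=.
have -> : cast_ord (esym (addn1 l.+1)) ord_max = rshift l.+1 (ord0 : 'I_1).
  by apply: val_inj; rewrite /= addn0.
have -> : cast_ord (esym (addn1 l.+1)) ord0 = lshift 1 (ord0 : 'I_l.+1).
  by apply: val_inj.
rewrite block_mxEdl mxE scale0r addr0; apply: eq_bigr => i _.
rewrite /B castmxE /= /E ltn_ord.
have -> : cast_ord (esym (addn1 l.+1)) (widen_ord (leqnSn l.+1) i) = lshift 1 i.
  by apply: val_inj.
have -> : cast_ord (esym (addn1 l.+1)) ord0 = lshift 1 (ord0 : 'I_l.+1).
  by apply: val_inj.
by rewrite block_mxEul.
Qed.

End SzegoRecursion.

Section SzegoOrthogonality.
Variables (R : realType) (V : lmodType R[i]).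
Local Notation C := R[i].
Variables (ip : V -> V -> C) (ipP : posdef_form ip).
Variables (x : nat -> V) (coord : nat -> V -> C).

Definition supported a b (v : V) : Prop :=
  forall i, ~~ (a <= i < b)%N -> coord i v = 0.

(** Only elements supported in a finite segment are required to have an expansion, so
    that no infinite sum occurs. *)
Record coordinates : Prop := {
  coordD : forall i u v, coord i (u + v) = coord i u + coord i v;
  coordZ : forall i c u, coord i (c *: u) = c * coord i u;
  coordx : forall i j, coord i (x j) = (i == j)%:R;
  coord_expand : forall a b v, supported a b v ->
    v = \sum_(a <= i < b) coord i v *: x i
}.

Hypothesis coordP : coordinates.

Lemma supportedW a b a' b' v : (a' <= a)%N -> (b <= b')%N ->
  supported a b v -> supported a' b' v.
Proof.
move=> aa bb vs i iab; apply: vs; apply: contra iab => /andP[ai ib].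
by rewrite (leq_trans aa ai) (leq_trans ib bb).
Qed.

Lemma supportedD a b u v : supported a b u -> supported a b v -> supported a b (u + v).
Proof. by move=> us vs i iab; rewrite (coordD coordP) us // vs // addr0. Qed.

Lemma supportedZ a b c u : supported a b u -> supported a b (c *: u).
Proof. by move=> us i iab; rewrite (coordZ coordP) us // mulr0. Qed.

Lemma coordN i u : coord i (- u) = - coord i u.
Proof. by rewrite -scaleN1r (coordZ coordP) mulN1r. Qed.

Lemma supportedN a b u : supported a b u -> supported a b (- u).
Proof. by rewrite -scaleN1r; apply: supportedZ. Qed.

Lemma supported_x k : supported k k.+1 (x k).
Proof.
move=> i; rewrite (coordx coordP) ltnS -eqn_leq eq_sym.
by move=> /negbTE ->.
Qed.

Lemma coord_sum (I : Type) (s : seq I) (f : I -> V) i :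
  coord i (\sum_(j <- s) f j) = \sum_(j <- s) coord i (f j).
Proof.
apply: (big_morph (coord i) (coordD coordP i)).
by rewrite -(scale0r (0 : V)) (coordZ coordP) mul0r.
Qed.

Lemma supported_orth a b u v : supported a b v ->
  (forall i, (a <= i < b)%N -> ip u (x i) = 0) -> ip u v = 0.
Proof.
move=> /(coord_expand coordP) -> uo; rewrite (pform_sumr ipP) big_nat big1 // => i iab.
by rewrite (pformZr ipP) uo // mulr0.
Qed.

(** Two unit vectors of the span of [x a, ..., x j] that are both orthogonal to
    [x a, ..., x j.-1] are collinear, and the sign of the leading coefficient
    removes the remaining ambiguity. *)
Lemma gram_schmidt_unique a j u v : (a <= j)%N ->
  supported a j.+1 u -> supported a j.+1 v ->
  (forall i, (a <= i < j)%N -> ip u (x i) = 0) ->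
  (forall i, (a <= i < j)%N -> ip v (x i) = 0) ->
  ip u u = 1 -> ip v v = 1 -> 0 < coord j u -> 0 < coord j v -> u = v.
Proof.
move=> aj us vs uo vo u1 v1 ju jv.
set c := coord j u in ju *; set c' := coord j v in jv *.
have w0 : c' *: u - c *: v = 0.
  apply: (pform_eq0 ipP); apply: (@supported_orth a j).
    move=> i iaj; have [->|ij] := eqVneq i j.
      by rewrite (coordD coordP) coordN !(coordZ coordP) mulrC subrr.
    have iaj1 : ~~ (a <= i < j.+1)%N.
      by apply: contra iaj => /andP[-> ] /=; rewrite ltnS ltn_neqAle ij => ->.
    by rewrite (coordD coordP) coordN !(coordZ coordP) us // vs // !mulr0 subrr.
  by move=> i iaj; rewrite (pformBl ipP) !(pformZl ipP) uo // vo // !mulr0 subrr.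
have uv : c' *: u = c *: v by apply/eqP; rewrite -subr_eq0 w0.
have cc : c = c'.
  have := congr1 (fun w => ip w w) uv.
  rewrite /= !(pformZl ipP) !(pformZr ipP) u1 v1 !mulr1 -!normCK.
  move/eqP; rewrite eqrXn2 ?normr_ge0 // !gtr0_norm // => /eqP ->.
  by [].
by move: uv; rewrite cc => /(scalerI (lt0r_neq0 jv)).
Qed.

Variable gamma : nat -> nat -> C.
Hypothesis x1 : forall k, ip (x k) (x k) = 1.
Hypothesis gammaP : schur_params (fun k j => ip (x j) (x k)) gamma.
Local Notation F l k := (szego x gamma l k).1.
Local Notation G l k := (szego x gamma l k).2.

Record szego_spec l k : Prop := {
  szegoF_supp : supported k (k + l).+1 (F l k);
  szegoF_lead : 0 < coord (k + l) (F l k);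
  szegoF_unit : ip (F l k) (F l k) = 1;
  szegoF_orth : forall i, (k <= i < k + l)%N -> ip (F l k) (x i) = 0;
  szegoG_supp : supported k (k + l).+1 (G l k);
  szegoG_lead : 0 < coord k (G l k);
  szegoG_unit : ip (G l k) (G l k) = 1;
  szegoG_orth : forall i, (k < i <= k + l)%N -> ip (G l k) (x i) = 0
}.

(** By induction on [l] the parameters [gamma] are the geometric ones.  The point is
    that [F l.+1 k] is orthogonal to [x k].  Taking the inner product of the expansion
    [schur_mx_col] with [x k] kills the middle terms by induction, and the hypothesis
    on [gamma] identifies the left-hand side with the first term, so the last term
    vanishes; its coefficient is not zero since [x (k + l.+1)] occurs in no other
    term.  The remaining assertions follow from the recursion. *)
Lemma szegoP l k : szego_spec l k.
Proof.
elim/ltn_ind: l k => -[_ k|l IH k].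
  split; rewrite ?addn0 //=.
  - exact: supported_x.
  - by rewrite (coordx coordP) eqxx ltr01.
  - by move=> i /andP[ki]; rewrite ltnNge ki.
  - exact: supported_x.
  - by rewrite (coordx coordP) eqxx ltr01.
  - by move=> i /andP[ki]; rewrite leqNgt ki.
have kl : (k < k + l.+1)%N by rewrite addnS ltnS leq_addr.
have [g1 gs] := gammaP kl.
have gamma_lt1 a b : (a < b)%N -> `|gamma a b| < 1 by move=> /gammaP[].
have [FS' Fl' Fu' Fo' _ _ _ _] := IH l (ltnSn l) k.+1.
have [_ _ _ _ GS Gl Gu Go] := IH l (ltnSn l) k.
set g := gamma k (k + l.+1)%N in g1.
have d0 := defect_gt0 g1; have dd := sqr_defect g.
have FE : F l.+1 k = (defect g)^-1 *: (F l k.+1 - g *: G l k) by [].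
have GE : G l.+1 k = (defect g)^-1 *: (- g^* *: F l k.+1 + G l k) by [].
have dJ : ((defect g)^-1)^* = (defect g)^-1.
  by apply/CrealP; rewrite realV gtr0_real.
rewrite !addSn in FS' Fl' Fo'.
have FS : supported k (k + l.+1).+1 (F l.+1 k).
  rewrite FE addnS; apply/supportedZ/supportedD.
    exact: supportedW FS'.
  by apply/supportedN/supportedZ; exact: supportedW GS.
have Fl : 0 < coord (k + l.+1)%N (F l.+1 k).
  rewrite FE (coordZ coordP) (coordD coordP) coordN (coordZ coordP) addnS.
  rewrite [coord _ (G l k)]GS ?ltnn ?andbF // mulr0 subr0.
  by rewrite mulr_gt0 // invr_gt0.
have col := schur_mx_col x gamma_lt1 l.+1 k.
have Uk : schur_mx gamma l.+1 k ord0 ord0 = ip (x (k + l.+1)%N) (x k).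
  by rewrite gs !x1 sqrtC1 mul1r mulr1 addKn.
move: (schur_mx gamma l.+1 k) col Uk => W col Uk.
have F_x_k : ip (F l.+1 k) (x k) = 0.
  set U := W ord_max ord0.
  have U0 : U != 0.
    have := congr1 (coord (k + l.+1)%N) col.
    rewrite coord_sum (coordx coordP) eqxx big_ord_recr /= big1 => [|i _].
      rewrite add0r -/(szego x gamma l.+1 k) (coordZ coordP) => E.
      by apply/eqP => U0; move: E; rewrite -/U U0 mul0r => /eqP; rewrite eq_sym oner_eq0.
    rewrite (coordZ coordP) (szegoF_supp (IH i _ k)) ?ltn_ord ?mulr0 //.
    rewrite addnS ltnS ltn_add2l; have := ltn_ord i; rewrite ltnS leqNgt => /negbTE ->.
    by rewrite andbF.
  have := congr1 (fun v => ip v (x k)) col.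
  rewrite /= (pform_suml ipP) big_ord_recl big_ord_recr /= big1 => [|i _]; last first.
        rewrite (pformZl ipP) [X in _ * X](_ : _ = 0) ?mulr0 //.
    apply: (szegoF_orth (IH i.+1 _ k)); first by rewrite ltnS ltn_ord.
    by rewrite leqnn addnS ltnS leq_addr.
  rewrite -/(szego x gamma l.+1 k) (pformZl ipP) x1 mulr1 Uk add0r => /eqP.
  rewrite -subr_eq0 addrC addKr (pformZl ipP) mulf_eq0.
  have -> : lift ord0 ord_max = ord_max :> 'I_l.+2 by apply: val_inj.
  by rewrite (negbTE U0) => /eqP.
have Fo i : (k <= i < k + l.+1)%N -> ip (F l.+1 k) (x i) = 0.
  rewrite leq_eqVlt addnS ltnS => /andP[/orP[/eqP <- //|ki] il].
  rewrite FE (pformZl ipP) (pformBl ipP) (pformZl ipP) Fo' ?ki // Go ?ki //.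
  by rewrite mulr0 subrr mulr0.
(* The parameter is the inner product that the recursion subtracts. *)
have gE : ip (F l k.+1) (G l k) = g.
  have : ip (F l.+1 k) (G l k) = 0.
    by apply: (supported_orth GS) => i; rewrite -addnS; exact: Fo.
  rewrite FE (pformZl ipP) (pformBl ipP) (pformZl ipP) Gu mulr1 => /eqP.
  by rewrite mulf_eq0 invr_eq0 gt_eqF //= subr_eq0 => /eqP.
have gE' : ip (G l k) (F l k.+1) = g^* by rewrite (pform_conj ipP) gE.
have dn : (defect g)^-1 * ((defect g)^-1 * (1 - g * g^*)) = 1.
  by rewrite -dd expr2 mulKf ?gt_eqF // mulVf ?gt_eqF.
split=> //.
- rewrite FE (pformZl ipP) (pformZr ipP) dJ !(pformBl ipP, pformBr ipP).
  rewrite !(pformZl ipP, pformZr ipP) Fu' Gu gE gE' -[RHS]dn.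
  by congr (_ * (_ * _)); ring.
- rewrite GE addnS; apply/supportedZ/supportedD.
    by apply/supportedZ; exact: supportedW FS'.
  exact: supportedW GS.
- rewrite GE (coordZ coordP) (coordD coordP) (coordZ coordP).
  rewrite [coord _ (F l k.+1)]FS' ?ltnn // mulr0 add0r.
  by rewrite mulr_gt0 // invr_gt0.
- rewrite GE (pformZl ipP) (pformZr ipP) dJ !(pformDl ipP, pformDr ipP).
  rewrite !(pformZl ipP, pformZr ipP) rmorphN /= conjCK Fu' Gu gE gE' -[RHS]dn.
  by congr (_ * (_ * _)); ring.
have Go' i : (k < i <= k + l)%N -> ip (G l.+1 k) (x i) = 0.
  move=> kil; rewrite GE (pformZl ipP) (pformDl ipP) (pformZl ipP).
  by rewrite Fo' // Go // mulr0 addr0 mulr0.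
have GF : ip (G l.+1 k) (F l k.+1) = 0.
  by rewrite GE (pformZl ipP) (pformDl ipP) (pformZl ipP) Fu' gE' mulr1 addNr mulr0.
move=> i; rewrite addnS [(i <= _)%N]leq_eqVlt => /andP[ki /orP[/eqP ->|]]; last first.
  by rewrite ltnS => il; apply: Go'; rewrite ki.
(* Orthogonality to the leading vector of [F l k.+1] suffices. *)
move: GF; rewrite [X in ip _ X](coord_expand coordP FS').
rewrite (pform_sumr ipP) big_nat_recr ?ltnS ?leq_addr //= big_nat big1 => [|j jl].
  rewrite add0r (pformZr ipP) => /eqP; rewrite mulf_eq0 conjC_eq0 gt_eqF //=.
  by move/eqP.
by rewrite (pformZr ipP) Go' ?mulr0.
Qed.

End SzegoOrthogonality.

(** * Words as an enumerated basis *)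

#[local] Opaque inner.

Section WordCoordinates.
Variables (R : realType) (N : nat).
Hypothesis N_gt0 : (0 < N)%N.
Local Notation C := R[i].
Local Notation mono w := (@mkmalgU (word N) C w 1).
Implicit Types (p q : ncpoly R N) (u v w : word N).

Definition monom (i : nat) : ncpoly R N := mono (word_at i).
Definition word_coef (i : nat) (p : ncpoly R N) : C := mcoeff (word_at i) p.

Lemma word_rank0 : word_rank ([::] : word N) = 0%N.
Proof. by []. Qed.

Lemma word_at0 : word_at 0 = [::] :> word N.
Proof. by []. Qed.

Lemma monomE w : monom (word_rank w) = mono w.
Proof. by rewrite /monom word_rankK. Qed.

Lemma word_coefE w p : word_coef (word_rank w) p = mcoeff w p.
Proof. by rewrite /word_coef word_rankK. Qed.

Lemma word_coordinates : coordinates monom word_coef.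
Proof.
split=> [i u v|i c u|i j|a b v vs].
- exact: mcoeffD.
- exact: mcoeffZ.
- by rewrite /word_coef /monom mcoeffU (can_eq (word_atK N_gt0)) eq_sym.
apply/malgP => w; rewrite -word_coefE raddf_sum /=.
have coefx i : mcoeff w (word_coef i v *: monom i) =
    if i == word_rank w then word_coef i v else 0.
  rewrite mcoeffZ mcoeffU -(can_eq (word_atK N_gt0)) (word_rankK N_gt0).
  by case: eqP; rewrite ?mulr1 ?mulr0.
under eq_bigr do rewrite coefx.
rewrite -big_mkcond /=.
have [/andP[aw wb]|wab] := boolP (a <= word_rank w < b)%N; last first.
  rewrite vs // big_nat_cond big1 // => i /andP[iab /eqP iw].
  by rewrite -iw iab in wab.
by rewrite big_nat1_eq aw wb.
Qed.

Lemma mcoeff_ncX k p v :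
  mcoeff v (ncX R k * p) =
  if v is j :: u then (if j == k then mcoeff u p else 0) else 0.
Proof.
have -> : ncX R k * p = \sum_(u <- msupp p) mkmalgU (k :: u) (mcoeff u p).
  rewrite malgM_def; apply: (etrans (fgmulUg _ _ _)).
  by apply: eq_bigr => u _; rewrite mul1r.
rewrite raddf_sum /=; under eq_bigr do rewrite mcoeffU.
case: v => [|j v]; first by rewrite big1.
case: eqP => [->|/eqP jk]; last first.
  by rewrite big1 // => u _; rewrite eqseq_cons eq_sym (negbTE jk).
under eq_bigr do rewrite eqseq_cons eqxx /=.
rewrite [in RHS](monalgE p) raddf_sum /=.
by apply: eq_bigr => u _; rewrite mcoeffU.
Qed.

Variable phi : {scalar toep R N}.
Hypotheses (phi1 : phi 1 = 1) (phi_pos : strictly_positive phi).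
Let ipP := inner_form phi_pos.

Lemma inner_monom1 i : inner phi (monom i) (monom i) = 1.
Proof. exact: inner_mono1. Qed.

Variable f : word N -> ncpoly R N.
Hypothesis fP : gram_schmidt phi f.

Lemma gram_schmidt_supp w : supported word_coef 0 (word_rank w).+1 (f w).
Proof.
move=> i; rewrite /= -leqNgt => wi; apply: (gram_schmidt_trig fP).
by rewrite shortlex_rank word_atK.
Qed.

Lemma gram_schmidt_orth_monom w i : (i < word_rank w)%N ->
  inner phi (f w) (monom i) = 0.
Proof.
elim/ltn_ind: i => i IH iw.
set v := word_at i : word N.
have iv : word_rank v = i by rewrite word_atK.
have : inner phi (f w) (f v) = 0.
  by rewrite (gram_schmidt_orth fP) -(can_eq (word_rankK N_gt0)) iv gtn_eqF.
rewrite [X in inner _ _ X](coord_expand word_coordinates (@gram_schmidt_supp v)) iv.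
rewrite (pform_sumr ipP) big_nat_recr //= big_nat big1 => [|j /andP[_ ji]].
  rewrite add0r (pformZr ipP) => /eqP; rewrite mulf_eq0 conjC_eq0.
  by rewrite gt_eqF ?(gram_schmidt_lead fP) //= => /eqP.
by rewrite (pformZr ipP) IH ?mulr0 // (ltn_trans ji).
Qed.

Variable gamma : nat -> nat -> C.
Hypothesis gammaP : schur_params (word_kernel (moment_kernel phi)) gamma.

Lemma szego_monomP l k :
  szego_spec (inner phi) monom word_coef gamma l k.
Proof.
exact: (szegoP ipP word_coordinates inner_monom1 gammaP).
Qed.

(** The nonempty words that precede [k :: w] either begin with another letter, and
    span a subspace orthogonal to the range of [X_k], or are [k :: u] with [u] before
    [w].  So [X_k] carries the orthonormalisation of [X_w] against the smaller words to
    that of [X_(kw)] against the smaller nonempty words. *)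
Lemma szego_shift k w l : word_rank (k :: w) = l.+1 ->
  (szego monom gamma l 1).1 = ncX R k * f w.
Proof.
move=> kwl; have [Fs Fl F1 Fo _ _ _ _] := szego_monomP l 1.
have wE : word_at l.+1 = k :: w by rewrite -kwl word_rankK.
rewrite add1n in Fs Fl Fo.
have Gs : supported word_coef 1 l.+2 (ncX R k * f w).
  move=> i il; rewrite /word_coef mcoeff_ncX.
  case iE : (word_at i) => [//|j u]; case: eqP => // jk; subst j.
  apply: (gram_schmidt_trig fP); rewrite -(shortlex_cons k) -iE -wE.
  rewrite shortlex_rank !word_atK // ltnNge -ltnS; apply: contra il => ->.
  by rewrite andbT lt0n; apply: contra_eq_neq iE => ->; rewrite word_at0.
have Go i : (1 <= i < l.+1)%N -> inner phi (ncX R k * f w) (monom i) = 0.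
  move=> /andP[i0 il]; rewrite /monom.
  case iE : (word_at i) => [|j u].
    by have := word_atK N_gt0 i; rewrite iE word_rank0 => i0'; rewrite -i0' in i0.
  rewrite -ncX_mono inner_mulX; case: eqP => // kj; subst j.
  rewrite -monomE gram_schmidt_orth_monom // -shortlex_rank -(shortlex_cons k) -iE -wE.
  by rewrite shortlex_rank !word_atK.
have G1 : inner phi (ncX R k * f w) (ncX R k * f w) = 1.
  by rewrite inner_mulX eqxx (gram_schmidt_orth fP) eqxx.
have Gl : 0 < word_coef l.+1 (ncX R k * f w).
  by rewrite /word_coef wE mcoeff_ncX eqxx (gram_schmidt_lead fP).
exact: (gram_schmidt_unique ipP word_coordinates _ Fs Gs Fo Go F1 G1 Fl Gl).
Qed.

Variable fs : word N -> ncpoly R N.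
Hypothesis fsP : companion gamma f fs.

(** With [szego_shift] the recursion of the companion polynomials is the second half
    of the Szego recursion started at the empty word. *)
Lemma companion_szego w : fs w = (szego monom gamma (word_rank w) 0).2.
Proof.
have [m] := ubnP (word_rank w); elim: m w => // m IH w; rewrite ltnS => wm.
have [fs0 fsS] := fsP.
case: w wm => [|k w] wm.
  by rewrite word_rank0 /= fs0 /monom word_at0.
case E : (word_rank (k :: w)) => [|l].
  by have := word_rankK N_gt0 (k :: w); rewrite E word_at0.
have -> : (szego monom gamma l.+1 0).2 = (defect (gamma 0 l.+1))^-1 *:
    (- (gamma 0 l.+1)^* *: (ncX R k * f w) + (szego monom gamma l 0).2).
  by rewrite -(szego_shift E).
have IHl : fs (word_at l) = (szego monom gamma l 0).2.
  by rewrite IH word_atK // -ltnS -E.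
by rewrite fsS /word_param /word_pred E IHl.
Qed.

End WordCoordinates.

Arguments monom {R N} i.
Arguments word_coef {R N} i p.

(** * Arrays with square-summable columns and their kernels *)

Section SquareSummable.
Variable R : realType.
Local Notation C := R[i].

Lemma sqr_normcE (z : C) : `|z| ^+ 2 = ((Normc.normc z) ^+ 2)%:C%C.
Proof. by rewrite rmorphXn. Qed.

Variable N : nat.
Implicit Types (f g : word N -> C) (e : R).

Lemma sum_sqr_normcE f n : \sum_(i < n) `|f (word_at i)| ^+ 2 =
  (\sum_(i < n) Normc.normc (f (word_at i)) ^+ 2)%:C%C.
Proof. by rewrite rmorph_sum; apply: eq_bigr => i _; rewrite sqr_normcE. Qed.

Lemma sqnorm_partial f e n : (sqnorm f < e%:E)%E ->
  \sum_(i < n) `|f (word_at i)| ^+ 2 <= e%:C%C.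
Proof.
move=> fe; have : (\sum_(0 <= i < n) ((Normc.normc (f (word_at i)) ^+ 2)%:E) <= e%:E)%E.
  apply: le_trans (ltW fe); apply: nneseries_lim_ge => i _ _.
  by rewrite lee_fin sqr_ge0.
by rewrite sumEFin lee_fin big_mkord -lecR -sum_sqr_normcE.
Qed.

Lemma sqnorm_le f e : (forall n, \sum_(i < n) `|f (word_at i)| ^+ 2 <= e%:C%C) ->
  (sqnorm f <= e%:E)%E.
Proof.
move=> fe; apply: lime_le.
  by apply: is_cvg_nneseries => i _ _; rewrite lee_fin sqr_ge0.
apply: nearW => n; by rewrite sumEFin lee_fin big_mkord -lecR -sum_sqr_normcE.
Qed.

Lemma sqnorm_ltoo f : (sqnorm f < +oo)%E ->
  exists M : R, forall n, \sum_(i < n) `|f (word_at i)| ^+ 2 <= M%:C%C.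
Proof.
case E : (sqnorm f) => [r| |] // _.
  by exists (r + 1) => n; apply: sqnorm_partial; rewrite E lte_fin ltrDl.
exists 0 => n; apply: sqnorm_partial; rewrite E; exact: ltNyr.
Qed.

Lemma is_cvg_series_conjM f g : (sqnorm f < +oo)%E -> (sqnorm g < +oo)%E ->
  exists l : C, (series (fun n => (f (word_at n))^* * g (word_at n) : C^o)) @ \oo
    --> (l : C^o).
Proof.
move=> /sqnorm_ltoo[M fM] /sqnorm_ltoo[M' gM].
pose t n := Normc.normc (f (word_at n)) ^+ 2 + Normc.normc (g (word_at n)) ^+ 2.
have t0 n : 0 <= t n by rewrite addr_ge0 ?sqr_ge0.
pose r n := \sum_(0 <= i < n) t i.
have rD n m : (n <= m)%N -> r m - r n = \sum_(n <= i < m) t i.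
  by move=> nm; rewrite /r (big_cat_nat (leq0n n) nm) /= addrC addrK.
have r_nd : {homo r : n m / (n <= m)%N >-> n <= m}.
  by move=> n m nm; rewrite -subr_ge0 rD // sumr_ge0.
have rM n : r n <= M + M'.
  rewrite -lecR rmorphD /=; apply: le_trans (lerD (fM n) (gM n)).
  by rewrite !sum_sqr_normcE -rmorphD lecR /= /r big_mkord big_split.
have M0 : 0 <= M + M' by apply: le_trans (rM 0%N); rewrite /r big_geq.
apply: (cvg_of_sqdist r_nd rM M0) => n m nm.
have S : `|series (fun n => (f (word_at n))^* * g (word_at n) : C^o) n -
    series (fun n => (f (word_at n))^* * g (word_at n) : C^o) m| <= (r m - r n)%:C%C.
  rewrite distrC /series /= (big_cat_nat (leq0n n) nm) /= addrC addrK rD //.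
  apply: le_trans (ler_norm_sum _ _ _) _; rewrite rmorph_sum /=.
  apply: ler_sum => i _; rewrite normrM norm_conjC rmorphD /= -!sqr_normcE.
  set a := `|_|; set b := `|_|.
  have : 0 <= (a - b) ^+ 2 + (a ^+ 2 + b ^+ 2).
    apply: addr_ge0; last by apply: addr_ge0; apply: exprn_ge0; apply: normr_ge0.
    by apply: real_exprn_even_ge0 => //; apply: realB; apply: normr_real.
  rewrite (_ : _ + _ = 2 * (a ^+ 2 + b ^+ 2 - a * b)); last by ring.
  by rewrite pmulr_rge0 // subr_ge0.
have rr : 0 <= r m - r n by rewrite subr_ge0 r_nd.
apply: (@le_trans _ _ (((r m - r n) ^+ 2)%:C%C)).
  by rewrite rmorphXn lerXn2r ?nnegrE ?normr_ge0 // ler0c.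
rewrite lecR expr2 ler_wpM2r //; apply: le_trans (rM m).
by rewrite lerBlDr lerDl /r sumr_ge0.
Qed.

End SquareSummable.

Section ArrayKernels.
Variables (R : realType) (N : nat).
Local Notation C := R[i].
Local Notation mono w := (@mkmalgU (word N) C w 1).
Implicit Types (p q : ncpoly R N) (v w : word N) (K : word N -> word N -> C)
  (Theta : array R N).

(** The squared norm of [p] for the kernel [K]. *)
Definition kernel_form K p : C :=
  \sum_(v <- msupp p) \sum_(w <- msupp p) (mcoeff v p)^* * K v w * mcoeff w p.

Lemma kernel_le_form K1 K2 p : kernel_le K1 K2 -> kernel_form K1 p <= kernel_form K2 p.
Proof.
move=> /(_ (msupp p) (fun w => mcoeff w p) (fset_uniq _)) K12.
rewrite -subr_ge0; apply: le_trans K12 _; rewrite /kernel_form -sumrB.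
rewrite le_eqVlt; apply/orP; left; apply/eqP.
apply: eq_bigr => v _; rewrite -sumrB; apply: eq_bigr => w _.
by rewrite mulrBr mulrBl.
Qed.

(** The entry [v] of the image of [p] under the linear map that sends [X_w] to the
    column [w] of the array. *)
Definition array_eval Theta p v : C := mmap idfun (Theta v) p.

Lemma array_evalE Theta p v :
  array_eval Theta p v = \sum_(w <- msupp p) mcoeff w p * Theta v w.
Proof. by rewrite /array_eval mmapE. Qed.

Lemma array_evalD Theta p q v :
  array_eval Theta (p + q) v = array_eval Theta p v + array_eval Theta q v.
Proof. exact: raddfD. Qed.

Lemma array_evalZ Theta c p v : array_eval Theta (c *: p) v = c * array_eval Theta p v.
Proof.
rewrite [in RHS]array_evalE mulr_sumr.
transitivity (\sum_(k <- msupp p) mcoeff k (c *: p) * Theta v k).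
  exact: (mmapEw (msuppZ_le c p)).
by apply: eq_bigr => w _; rewrite mcoeffZ mulrA.
Qed.

Lemma array_evalU Theta w v : array_eval Theta (mono w) v = Theta v w.
Proof. by rewrite /array_eval mmapU mul1r. Qed.

Lemma array_eval_sum Theta (I : Type) (s : seq I) (F : I -> ncpoly R N) v :
  array_eval Theta (\sum_(i <- s) F i) v = \sum_(i <- s) array_eval Theta (F i) v.
Proof. exact: raddf_sum. Qed.

Lemma array_kernel_cvg Theta v w : (forall u, (sqnorm (Theta^~ u) < +oo)%E) ->
  (series (fun n => (Theta (word_at n) v)^* * Theta (word_at n) w : C^o)) @ \oo -->
  (array_kernel Theta v w : C^o).
Proof.
by move=> T; have [l /cvgP] := is_cvg_series_conjM (T v) (T w).
Qed.

(** The squared norm for [K_Theta] is the squared length of the image in the sequence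
    space. *)
Lemma array_form_cvg Theta p : (forall u, (sqnorm (Theta^~ u) < +oo)%E) ->
  (\sum_(i < n) `|array_eval Theta p (word_at i)| ^+ 2 : C^o) @[n --> \oo] -->
  (kernel_form (array_kernel Theta) p : C^o).
Proof.
move=> T; rewrite /kernel_form.
have -> : (fun n => \sum_(i < n) `|array_eval Theta p (word_at i)| ^+ 2 : C^o) =
    (fun n => \sum_(v <- msupp p) \sum_(w <- msupp p) (mcoeff v p)^* *
       series (fun n => (Theta (word_at n) v)^* * Theta (word_at n) w : C^o) n
       * mcoeff w p : C^o).
  apply/funext => n; rewrite /series /=.
  under [RHS]eq_bigr do under eq_bigr do rewrite big_mkord mulr_sumr mulr_suml.
  under [RHS]eq_bigr do rewrite exchange_big /=.
  rewrite exchange_big /=; apply: eq_bigr => i _.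
  rewrite normCK mulrC array_evalE rmorph_sum /= mulr_suml; apply: eq_bigr => v _.
  rewrite mulr_sumr; apply: eq_bigr => w _; rewrite rmorphM /=; ring.
apply: cvgc_sum => v _; apply: cvgc_sum => w _.
by apply: cvgc_mulr; apply: cvgc_mull; exact: array_kernel_cvg.
Qed.

Lemma array_form_le Theta p (B : C) : (forall u, (sqnorm (Theta^~ u) < +oo)%E) ->
  (forall n, \sum_(i < n) `|array_eval Theta p (word_at i)| ^+ 2 <= B) ->
  kernel_form (array_kernel Theta) p <= B.
Proof.
by move=> T pB; apply: (cvgc_le (@array_form_cvg Theta p T)); apply: nearW.
Qed.

Lemma array_form_ge Theta p n : (forall u, (sqnorm (Theta^~ u) < +oo)%E) ->
  \sum_(i < n) `|array_eval Theta p (word_at i)| ^+ 2 <=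
  kernel_form (array_kernel Theta) p.
Proof.
move=> T; apply: (cvgc_ge (@array_form_cvg Theta p T)); exists n => // m /= nm.
rewrite -!(big_mkord xpredT (fun i => `|array_eval Theta p (word_at i)| ^+ 2)).
rewrite [leRHS](big_cat_nat (leq0n n) nm) /= lerDl.
by rewrite sumr_ge0 // => i _; rewrite exprn_ge0.
Qed.

End ArrayKernels.

(** * Outer arrays and maximality of the spectral factor *)

Section OuterArrays.
Variables (R : realType) (N : nat).
Hypothesis N_gt0 : (0 < N)%N.
Local Notation C := R[i].
Local Notation mono w := (@mkmalgU (word N) C w 1).
Implicit Types (p q : ncpoly R N) (v w : word N) (Theta : array R N).

Lemma supported_bound p : exists m, supported word_coef 0 m p.
Proof.
exists (\max_(w <- msupp p) (word_rank w).+1) => i; rewrite /= -leqNgt => im.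
apply: mcoeff_outdom; apply/negP => ip.
have : ((word_rank (word_at i : word N)).+1 <= \max_(w <- msupp p) (word_rank w).+1)%N.
  by rewrite (big_fsetD1 _ ip) /= leq_maxl.
by rewrite word_atK // ltnNge im.
Qed.

Lemma array_eval_lower Theta p w : (forall v u, shortlex v u -> Theta v u = 0) ->
  array_eval Theta p w =
  \sum_(0 <= i < (word_rank w).+1) word_coef i p * Theta w (word_at i).
Proof.
move=> trig; have [m pm] := supported_bound p.
have pM : supported word_coef 0 (maxn m (word_rank w).+1) p.
  exact: (supportedW (leqnn 0) (leq_maxl _ _) pm).
rewrite [in LHS](coord_expand (word_coordinates _ N_gt0) pM) array_eval_sum.
rewrite (big_cat_nat (leq0n _) (leq_maxr m (word_rank w).+1)) /= [X in _ + X]big_nat.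
rewrite [X in _ + X]big1 ?addr0 => [|i /andP[wi _]].
  by apply: eq_bigr => i _; rewrite array_evalZ array_evalU.
by rewrite array_evalZ array_evalU trig ?mulr0 // shortlex_rank word_atK.
Qed.

(** The columns after the column [rho] of an outer array are total in the rows
    after [rho], so subtracting a combination of them removes column [rho] from
    these rows up to [e] and keeps its diagonal entry. *)
Lemma outer_distance F Theta rho (e : R) : outer F Theta -> 0 < e ->
  exists p : ncpoly R N, [/\ mcoeff rho p = 1,
    forall w, shortlex w rho -> mcoeff w p = 0 &
    forall n, \sum_(i < n) `|array_eval Theta p (word_at i)| ^+ 2 <=
      `|Theta rho rho| ^+ 2 + e%:C%C].
Proof.
move=> To e0; set r := word_at (word_rank rho).+1 : word N.
have rE w : shortlex w r = (word_rank w <= word_rank rho)%N.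
  by rewrite shortlex_rank word_atK // ltnS.
pose f v := if v == rho then 0 else Theta v rho.
have [|v|s [a [sr sa]]] := @outer_total _ _ _ _ To r f _ _ e e0.
- have [M TM] := sqnorm_ltoo (outer_sqsum To rho).
  apply: (@le_lt_trans _ _ M%:E); last exact: ltry.
  apply: sqnorm_le => n; apply: le_trans (TM n); apply: ler_sum => i _.
  by rewrite /f; case: ifP => // _; rewrite normr0 expr0n exprn_ge0.
- rewrite rE /f; case: eqP => // /eqP vr /orP[Fv|vrr]; first exact: (outer_supp To).
  apply: (outer_trig To); rewrite shortlex_rank ltn_neqAle vrr andbT.
  by rewrite (can_eq (word_rankK N_gt0)).
exists (mono rho - \sum_(w <- s) a w *: mono w).
have coefE u : mcoeff u (mono rho - \sum_(w <- s) a w *: mono w) =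
    (rho == u)%:R - \sum_(w <- s) a w * (w == u)%:R.
  rewrite mcoeffB mcoeffU raddf_sum /=; congr (_ - _).
  by apply: eq_bigr => w _; rewrite mcoeffZ mcoeffU.
have evE v : array_eval Theta (mono rho - \sum_(w <- s) a w *: mono w) v =
    Theta v rho - \sum_(w <- s) a w * Theta v w.
  rewrite array_evalD -scaleN1r array_evalZ mulN1r array_evalU array_eval_sum.
  by congr (_ - _); apply: eq_bigr => w _; rewrite array_evalZ array_evalU.
have low u : (word_rank u <= word_rank rho)%N -> \sum_(w <- s) a w * (w == u)%:R = 0.
  move=> ur; rewrite big_seq big1 // => w /sr; rewrite rE -ltnNge => rw.
  by case: eqP => [wu|]; rewrite ?mulr0 //; move: rw; rewrite wu ltnNge ur.
have row0 : \sum_(w <- s) a w * Theta rho w = 0.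
  rewrite big_seq big1 // => w /sr; rewrite rE -ltnNge => rw.
  by rewrite (outer_trig To) ?mulr0 // shortlex_rank.
split=> [|u|n].
- by rewrite coefE low // eqxx subr0.
- rewrite shortlex_rank => ur; rewrite coefE low ?(ltnW ur) // subr0.
  by case: eqP => // ru; move: ur; rewrite ru ltnn.
apply: le_trans (lerD (lexx _) (sqnorm_partial n sa)).
have dE v : `|array_eval Theta (mono rho - \sum_(w <- s) a w *: mono w) v| ^+ 2 =
    (if v == rho then `|Theta rho rho| ^+ 2 else 0) +
    `|f v - \sum_(w <- s) a w * Theta v w| ^+ 2.
  rewrite evE /f; case: eqP => [->|_]; last by rewrite add0r.
  by rewrite row0 !subr0 normr0 expr0n addr0.
under eq_bigr do rewrite dE.
rewrite big_split lerD2r /= -big_mkcond /=.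
rewrite (eq_bigl (fun i : 'I_n => i == word_rank rho :> nat)); last first.
  by move=> i; rewrite -(can_eq (word_rankK N_gt0)) word_atK.
have [rn|rn] := ltnP (word_rank rho) n; last first.
  rewrite big1 ?exprn_ge0 // => i /eqP ir.
  by have := ltn_ord i; rewrite ir ltnNge rn.
by rewrite (big_pred1 (Ordinal rn)).
Qed.

(** Arrays with a single row are the simplest outer arrays, taken with the space
    [F] concentrated at that row. *)
Definition row_array (rho : word N) (theta : word N -> C) : array R N :=
  fun v w => if v == rho then theta w else 0.

Section RowArray.
Variables (rho : word N) (theta : word N -> C).
Hypotheses (theta_rho : theta rho != 0)
  (theta_trig : forall w, shortlex rho w -> theta w = 0).

Let row_sum (g : word N -> C) n : (word_rank rho < n)%N ->
  (forall v, v != rho -> g v = 0) ->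
  \sum_(i < n) g (word_at i) = g rho.
Proof.
move=> rn g0; rewrite (bigD1 (Ordinal rn)) //= word_rankK // big1 ?addr0 // => i ir.
by apply: g0; rewrite -(can_eq (word_rankK N_gt0)) word_atK.
Qed.

Lemma row_array_sqsum w : (sqnorm ((row_array rho theta)^~ w) < +oo)%E.
Proof.
apply: (@le_lt_trans _ _ (Normc.normc (theta w) ^+ 2)%:E); last exact: ltry.
apply: sqnorm_le => n; rewrite -sqr_normcE.
have [rn|rn] := ltnP (word_rank rho) n.
  rewrite (row_sum (g := fun v => `|row_array rho theta v w| ^+ 2)) //.
    by rewrite /row_array eqxx.
  by move=> v vr; rewrite /row_array (negbTE vr) normr0 expr0n.
rewrite big1 ?exprn_ge0 // => i _; rewrite /row_array.
case: eqP => [ir|]; last by rewrite normr0 expr0n.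
by move: rn; rewrite -ir word_atK // leqNgt ltn_ord.
Qed.

Lemma row_array_outer : outer (pred1 rho) (row_array rho theta).
Proof.
split=> [v w|v w vw|w|r f _ f0 e e0].
- by rewrite /row_array /= => /negbTE ->.
- by rewrite /row_array; case: eqP => // vr; apply: theta_trig; rewrite -vr.
- exact: row_array_sqsum.
have sq0 (g : word N -> C) : (forall v, g v = 0) -> (sqnorm g < e%:E)%E.
  move=> g0; apply: (@le_lt_trans _ _ 0%:E); last by rewrite lte_fin.
  by apply: sqnorm_le => n; rewrite big1 // => i _; rewrite g0 normr0 expr0n.
have [rr|rr] := boolP (shortlex rho r).
  exists [::], (fun=> 0); split=> //; apply: sq0 => v; rewrite big_nil subr0.
  apply: f0; rewrite /=; case: (v =P rho) => [->|//]; by rewrite rr orbT.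
exists [:: rho], (fun=> f rho / theta rho); split=> [w|].
  by rewrite inE => /eqP ->.
apply: sq0 => v; rewrite big_seq1 /row_array.
case: eqP => [->|/eqP vr]; first by rewrite divfK // subrr.
by rewrite mulr0 subr0 f0 //= vr.
Qed.

Lemma row_array_kernel v w : array_kernel (row_array rho theta) v w = (theta v)^* * theta w.
Proof.
apply: (@cvg_lim C^o); first exact: norm_hausdorff.
apply: cvg_near_cst; exists (word_rank rho).+1 => // n /= rn.
rewrite /series /= big_mkord.
rewrite (row_sum (g := fun u =>
  (row_array rho theta u v)^* * row_array rho theta u w)) //.
  by rewrite /row_array eqxx.
by move=> u ur; rewrite /row_array (negbTE ur) mulr0.
Qed.

(** Maximality tested against the rank-one kernel of a single row.  The polynomial
    of [outer_distance] has norm almost [`|Theta rho rho|] for [K_Theta], and norm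
    [`|theta rho|] for the rank-one kernel because [theta] vanishes after [rho]. *)
Lemma spectral_factor_diag_ge K Theta : spectral_factor K Theta ->
  kernel_le (fun v w => (theta v)^* * theta w) K ->
  `|theta rho| ^+ 2 <= `|Theta rho rho| ^+ 2.
Proof.
move=> TP tK; have [F To] := spectral_factor_outer TP.
have rT : kernel_le (array_kernel (row_array rho theta)) (array_kernel Theta).
  apply: (spectral_factor_max TP row_array_outer) => s a us.
  by under eq_bigr do under eq_bigr do rewrite row_array_kernel; exact: tK.
rewrite !sqr_normcE lecR; apply/ler_addgt0Pr => e e0.
rewrite -lecR rmorphD /= -!sqr_normcE.
have [p [p1 p0 pn]] := outer_distance rho To e0.
apply: le_trans (array_form_le (outer_sqsum To) pn).
apply: le_trans (kernel_le_form p rT).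
apply: le_trans (array_form_ge p (word_rank rho).+1 row_array_sqsum).
rewrite big_ord_recr /= word_rankK // [X in _ <= _ + X](_ : _ = `|theta rho| ^+ 2).
  by rewrite lerDr sumr_ge0 // => i _; rewrite exprn_ge0.
rewrite array_eval_lower; last exact: (outer_trig row_array_outer).
rewrite big_nat_recr //= word_rankK // big_nat big1 => [|i /andP[_ ir]].
  by rewrite add0r word_coefE // p1 mul1r /row_array eqxx.
by rewrite /word_coef p0 ?mul0r // shortlex_rank word_atK.
Qed.

End RowArray.

End OuterArrays.

(** * Bounded coefficient functionals *)

Section MomentBounds.
Variables (R : realType) (N : nat).
Hypothesis N_gt0 : (0 < N)%N.
Local Notation C := R[i].
Local Notation mono w := (@mkmalgU (word N) C w 1).
Implicit Types (p q : ncpoly R N) (v w : word N) (Theta : array R N).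
Variable phi : {scalar toep R N}.
Hypothesis phi_pos : strictly_positive phi.
Let ipP := inner_form phi_pos.

Lemma inner_kernel (s : seq (word N)) (a : word N -> C)
    (p := \sum_(w <- s) a w *: mono w) :
  inner phi p p = \sum_(v <- s) \sum_(w <- s) (a v)^* * moment_kernel phi v w * a w.
Proof.
rewrite /p (pform_sumr ipP); apply: eq_bigr => v _.
rewrite (pformZr ipP) (pform_suml ipP) mulr_sumr; apply: eq_bigr => w _.
by rewrite (pformZl ipP) inner_mono -mulrA [X in _ = _ * X]mulrC.
Qed.

Lemma sum_rank_one (K : word N -> word N -> C) (theta : word N -> C)
    (s : seq (word N)) (a : word N -> C) :
  \sum_(v <- s) \sum_(w <- s) (a v)^* * (K v w - (theta v)^* * theta w) * a w =
  \sum_(v <- s) \sum_(w <- s) (a v)^* * K v w * a w -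
  `|\sum_(w <- s) a w * theta w| ^+ 2.
Proof.
rewrite normCK mulrC rmorph_sum mulr_suml -sumrB.
apply: eq_bigr => v _; rewrite mulr_sumr -sumrB; apply: eq_bigr => w _.
by rewrite rmorphM /=; ring.
Qed.

Lemma kernel_form_moment p : kernel_form (moment_kernel phi) p = inner phi p p.
Proof.
have {2 3}-> : p = \sum_(w <- msupp p) mcoeff w p *: mono w.
  rewrite {1}(monalgE p); apply: eq_bigr => w _; apply/malgP => v.
  by rewrite mcoeffZ !mcoeffU mulr_natr.
by rewrite inner_kernel.
Qed.

Lemma array_eval_bound F Theta p n : outer F Theta ->
  kernel_le (array_kernel Theta) (moment_kernel phi) ->
  \sum_(i < n) `|array_eval Theta p (word_at i)| ^+ 2 <= inner phi p p.
Proof.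
move=> To TK; apply: le_trans (array_form_ge p n (outer_sqsum To)) _.
by rewrite -kernel_form_moment; exact: kernel_le_form.
Qed.

Lemma array_eval_bound1 F Theta p w : outer F Theta ->
  kernel_le (array_kernel Theta) (moment_kernel phi) ->
  `|array_eval Theta p w| <= sqrtC (inner phi p p).
Proof.
move=> To TK; rewrite -(ler_pXn2r (ltn0Sn 1)) ?nnegrE ?normr_ge0 ?sqrtC_ge0
  ?(pform_ge0 ipP) // sqrtCK.
apply: le_trans (array_eval_bound p (word_rank w).+1 To TK).
by rewrite big_ord_recr /= word_rankK // lerDr sumr_ge0.
Qed.

(** Evaluating a lower triangular array is invertible when the diagonal does
    not vanish, so a minorant of the moment kernel with positive diagonal makes
    all coefficient functionals bounded. *)
Lemma coef_bound F Theta n : outer F Theta ->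
  kernel_le (array_kernel Theta) (moment_kernel phi) ->
  (forall w, 0 < Theta w w) ->
  exists2 B : C, 0 <= B & forall i p, (i < n)%N ->
    `|word_coef i p| <= B * sqrtC (inner phi p p).
Proof.
move=> To TK T0; elim: n => [|n [B B0 IH]]; first by exists 0.
set w := word_at n : word N.
pose D := (1 + \sum_(0 <= i < n) B * `|Theta w (word_at i)|) / Theta w w.
have D0 : 0 <= D.
  rewrite mulr_ge0 ?invr_ge0 ?(ltW (T0 _)) // addr_ge0 // sumr_ge0 // => i _.
  by rewrite mulr_ge0.
exists (B + D) => [|i p]; first exact: addr_ge0.
have nrm0 : 0 <= sqrtC (inner phi p p) by rewrite sqrtC_ge0 (pform_ge0 ipP).
rewrite ltnS leq_eqVlt => /orP[/eqP ->|ilt]; last first.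
  by apply: le_trans (IH i p ilt) _; rewrite mulrDl lerDl mulr_ge0.
apply: (@le_trans _ _ (D * sqrtC (inner phi p p))); last first.
  by rewrite mulrDl lerDr mulr_ge0.
have := array_eval_lower N_gt0 p w (outer_trig To).
rewrite word_atK // big_nat_recr //= -/w => E.
have -> : word_coef n p = (array_eval Theta p w -
    \sum_(0 <= i < n) word_coef i p * Theta w (word_at i)) / Theta w w.
  by rewrite E [X in X - _]addrC addrK mulfK // gt_eqF.
rewrite normrM normfV (gtr0_norm (T0 w)) /D mulrAC.
rewrite ler_wpM2r ?invr_ge0 ?(ltW (T0 _)) //.
apply: le_trans (ler_normB _ _) _; rewrite mulrDl mul1r.
apply: lerD; first exact: array_eval_bound1 To TK.
rewrite mulr_suml; apply: le_trans (ler_norm_sum _ _ _) _.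
rewrite big_nat [leRHS]big_nat; apply: ler_sum => j /andP[_ jn].
by rewrite normrM mulrAC ler_wpM2r // IH.
Qed.

Variable f : word N -> ncpoly R N.
Hypothesis fP : gram_schmidt phi f.

(** Bessel's inequality: the values of a bounded functional on an orthonormal
    sequence are square summable. *)
Lemma orthonormal_coef_cvg0 i (B : C) :
  (forall p, `|word_coef i p| <= B * sqrtC (inner phi p p)) -> 0 <= B ->
  (word_coef i (f (word_at n)) : C^o) @[n --> \oo] --> (0 : C^o).
Proof.
move=> iB B0; set c := fun n => word_coef i (f (word_at n)).
pose t n := Normc.normc (c n) ^+ 2.
have tE n : (t n)%:C%C = `|c n| ^+ 2 by rewrite sqr_normcE.
have bessel n : \sum_(j < n) `|c j| ^+ 2 <= B ^+ 2.
  set S := \sum_(j < n) _.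
  (* The functional is evaluated where the Cauchy-Schwarz inequality is sharp. *)
  pose p := \sum_(j < n) (c j)^* *: f (word_at j).
  have pS : word_coef i p = S.
    rewrite /p (coord_sum (word_coordinates R N_gt0)); apply: eq_bigr => j _.
    by rewrite (coordZ (word_coordinates R N_gt0)) normCK mulrC.
  have ppS : inner phi p p = S.
    rewrite {2}/p (pform_sumr ipP); apply: eq_bigr => j _.
    rewrite (pformZr ipP) conjCK (pform_suml ipP) (bigD1 j) //= big1 => [|k kj].
      by rewrite (pformZl ipP) (gram_schmidt_orth fP) eqxx mulr1 addr0 normCK.
    rewrite (pformZl ipP) (gram_schmidt_orth fP) (can_eq (word_atK N_gt0)).
    by rewrite val_eqE (negbTE kj) mulr0.
  have S0 : 0 <= S by rewrite -ppS (pform_ge0 ipP).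
  have := iB p; rewrite pS ppS (ger0_norm S0) -{1}[S]sqrtCK expr2.
  have [->|S0'] := eqVneq S 0; first by rewrite exprn_ge0.
  rewrite ler_pM2r; last by rewrite sqrtC_gt0 lt0r S0' S0.
  by rewrite -(ler_pXn2r (ltn0Sn 1)) ?nnegrE ?sqrtC_ge0 // sqrtCK.
have BR : B ^+ 2 = (complex.Re (B ^+ 2))%:C%C.
  by rewrite RRe_real // ger0_real // exprn_ge0.
have t0 : t @ \oo --> (0 : R).
  apply: cvg_series_cvg_0; apply: nondecreasing_is_cvgn.
    by apply: nondecreasing_series => n _ _; exact: sqr_ge0.
  exists (complex.Re (B ^+ 2)) => _ [n _ <-]; rewrite -lecR -BR /series /= big_mkord.
  by apply: le_trans (bessel n); rewrite rmorph_sum /=; under eq_bigr do rewrite tE.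
apply/cvgrPdist_lt => e e0.
have eE : (complex.Re e)%:C%C = e by rewrite RRe_real // gtr0_real.
have e0' : 0 < complex.Re e by rewrite -ltcR eE.
move/cvgrPdist_lt : t0 => /(_ _ (exprn_gt0 2 e0')).
apply: filterS => n; rewrite !sub0r !normrN ger0_norm ?sqr_ge0 // => tn.
rewrite -eE ltcR -(ltr_pXn2r (ltn0Sn 1)) ?nnegrE ?(ltW e0') //.
by case: (c n) => a b; exact: sqrtr_ge0.
Qed.

End MomentBounds.

(** * Convergence of the reverse Gram-Schmidt sequence *)

Section ReverseGramSchmidt.
Variables (R : realType) (N : nat).
Hypothesis N_gt0 : (0 < N)%N.
Local Notation C := R[i].
Local Notation mono w := (@mkmalgU (word N) C w 1).
Implicit Types (p q : ncpoly R N) (u v w : word N).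
Variable phi : {scalar toep R N}.
Hypotheses (phi1 : phi 1 = 1) (phi_pos : strictly_positive phi).
Let ipP := inner_form phi_pos.
Let coordP := word_coordinates R N_gt0.

(** [g n] is the normalised part of [1] orthogonal to the first [n] nonempty words:
    the companion polynomials in the enumeration of the words. *)
Record reverse_gram_schmidt (g : nat -> ncpoly R N) : Prop := {
  rgs_supp : forall n, supported word_coef 0 n.+1 (g n);
  rgs_lead : forall n, 0 < word_coef 0 (g n);
  rgs_unit : forall n, inner phi (g n) (g n) = 1;
  rgs_orth : forall n i, (0 < i <= n)%N -> inner phi (g n) (monom i) = 0
}.

Variable g : nat -> ncpoly R N.
Hypothesis gP : reverse_gram_schmidt g.
Local Notation b n := (word_coef 0 (g n)).

Hypothesis bounded_coef : forall i, exists2 B : C, 0 <= B &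
  forall p, `|word_coef i p| <= B * sqrtC (inner phi p p).

Lemma rgs_inner_monom n i : inner phi (monom i) (g n) = (inner phi (g n) (monom i))^*.
Proof. exact: (pform_conj ipP). Qed.

Lemma rgs_inner p n m : supported word_coef 0 n.+1 p -> (n <= m)%N ->
  inner phi p (g m) = word_coef 0 p * inner phi (monom 0) (g m).
Proof.
move=> pn nm; rewrite [X in inner _ X _](coord_expand coordP pn) (pform_suml ipP).
rewrite big_nat_recl // big_nat big1 => [|i /andP[_ i_n]].
  by rewrite addr0 (pformZl ipP).
rewrite (pformZl ipP) rgs_inner_monom (rgs_orth gP) ?conjC0 ?mulr0 //.
exact: leq_trans i_n nm.
Qed.

Lemma rgs_inner_one m : inner phi (monom 0) (g m) = (b m)^-1.
Proof.
have := rgs_inner (@rgs_supp _ gP m) (leqnn m); rewrite (rgs_unit gP) => E.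
have b0 := lt0r_neq0 (rgs_lead gP m).
by apply: (mulfI b0); rewrite -E mulfV.
Qed.

Lemma rgs_lead_conj n : (b n)^* = b n.
Proof. by apply/CrealP/gtr0_real/(rgs_lead gP). Qed.

(** Expanding [g n] on the words, only the constant term is seen by [g m], whence
    [<g n, g m> = b n / b m]. *)
Lemma rgs_dist n m : (n <= m)%N ->
  inner phi (g n - g m) (g n - g m) = 2 * (b m - b n) / b m.
Proof.
move=> nm; rewrite (pformBl ipP) !(pformBr ipP) !(rgs_unit gP).
rewrite (pform_conj ipP (g n) (g m)) (rgs_inner (@rgs_supp _ gP n) nm) rgs_inner_one.
have -> : (b n / b m)^* = b n / b m.
  by apply/CrealP/gtr0_real; rewrite divr_gt0 ?(rgs_lead gP).
have b0 := lt0r_neq0 (rgs_lead gP m).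
by field.
Qed.

Lemma rgs_lead_le n m : (n <= m)%N -> b n <= b m.
Proof.
move=> nm; have := pform_ge0 ipP (g n - g m); rewrite rgs_dist //.
rewrite -mulrA pmulr_rge0 // pmulr_lge0 ?invr_gt0 ?(rgs_lead gP) //.
by rewrite subr_ge0.
Qed.

(** The empty word is a unit vector. *)
Lemma rgs_lead0 : b 0%N = 1.
Proof.
have := rgs_unit gP 0%N.
rewrite {1 2}(coord_expand coordP (@rgs_supp _ gP 0%N)) big_nat1.
rewrite (pformZl ipP) (pformZr ipP) inner_monom1 // mulr1 rgs_lead_conj => /eqP.
rewrite -expr2 sqrf_eq1 => /orP[/eqP //|/eqP b1].
by have := rgs_lead gP 0%N; rewrite b1 ltr0N1.
Qed.

Let r n : R := complex.Re (b n).

Let rE n : (r n)%:C%C = b n.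
Proof. by rewrite RRe_real // gtr0_real // (rgs_lead gP). Qed.

Let r_nd : {homo r : n m / (n <= m)%N >-> n <= m}.
Proof. by move=> n m nm; rewrite -lecR !rE rgs_lead_le. Qed.

Let r_bounded : exists M, forall n, r n <= M.
Proof.
have [B B0 Bb] := bounded_coef 0; exists (complex.Re B) => n.
rewrite -lecR rE RRe_real ?ger0_real //; apply: le_trans (real_ler_norm _) _.
  by rewrite gtr0_real // (rgs_lead gP).
by have := Bb (g n); rewrite (rgs_unit gP) sqrtC1 mulr1.
Qed.

Lemma rgs_dist_le n m : (n <= m)%N ->
  inner phi (g n - g m) (g n - g m) <= (2 * (r m - r n))%:C%C.
Proof.
move=> nm; rewrite rgs_dist // rmorphM rmorphB /= !rE rmorph_nat.
rewrite ler_pdivrMr ?(rgs_lead gP) // ler_peMr ?mulr_ge0 ?subr_ge0 ?rgs_lead_le //.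
by rewrite -rgs_lead0 rgs_lead_le.
Qed.

(** Functionals bounded for the inner product converge along the sequence,
    since it is Cauchy: its distances are controlled by the increments
    of the bounded monotone sequence of constant coefficients. *)
Lemma rgs_functional_cvg (L : ncpoly R N -> C) (B : C) : 0 <= B ->
  (forall p q, L (p - q) = L p - L q) ->
  (forall p, `|L p| <= B * sqrtC (inner phi p p)) ->
  exists l : C, (L (g n) : C^o) @[n --> \oo] --> (l : C^o).
Proof.
move=> B0 LB Lb; have [M rM] := r_bounded.
have BE : (complex.Re (B ^+ 2))%:C%C = B ^+ 2.
  by rewrite RRe_real // ger0_real // exprn_ge0.
apply: (@cvg_of_sqdist _ _ r (complex.Re (B ^+ 2) * 2) M r_nd rM) => [|n m nm].
  by rewrite mulr_ge0 // -lecR BE exprn_ge0.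
rewrite -LB -mulrA rmorphM /= BE.
apply: le_trans (ler_wpM2l (exprn_ge0 2 B0) (rgs_dist_le nm)).
rewrite -[inner _ _ _]sqrtCK -exprMn lerXn2r ?nnegrE ?normr_ge0 //.
by rewrite mulr_ge0 // sqrtC_ge0 (pform_ge0 ipP).
Qed.

Lemma rgs_coef_cvg : exists c : ncseries R N, forall w,
  (mcoeff w (g n) : C^o) @[n --> \oo] --> (c w : C^o).
Proof.
suff /choice[c cP] : forall w, exists l : C,
    (mcoeff w (g n) : C^o) @[n --> \oo] --> (l : C^o) by exists c.
move=> w; have [B B0 wB] := bounded_coef (word_rank w).
apply: (rgs_functional_cvg B0) => [p q|p]; first exact: mcoeffB.
by have := wB p; rewrite word_coefE.
Qed.

Fixpoint word_shift w p : ncpoly R N :=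
  if w is k :: w' then ncX R k * word_shift w' p else p.

Lemma word_shiftB w p q : word_shift w (p - q) = word_shift w p - word_shift w q.
Proof. by elim: w => [//|k w IH]; rewrite /= IH mulrBr. Qed.

Lemma word_shift_cat w v : word_shift w (mono v) = mono (w ++ v).
Proof. by elim: w => [//|k w IH]; rewrite /= IH ncX_mono. Qed.

Lemma inner_word_shift w p q : inner phi (word_shift w p) (word_shift w q) = inner phi p q.
Proof. by elim: w => [//|k w IH]; rewrite /= inner_mulX eqxx. Qed.

Lemma mcoeff_word_shift w p v : mcoeff v (word_shift w p) =
  if prefix w v then mcoeff (drop (size w) v) p else 0.
Proof.
elim: w v => [|k w IH] v; first by rewrite prefix0s drop0.
rewrite [word_shift _ _]/= mcoeff_ncX; case: v => [|j v] //.
by rewrite IH /= eq_sym; case: (k == j).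
Qed.

(** Either [w = rho u] with [u] nonempty, and [g n] is orthogonal to [X_u], or the two
    words first differ at a letter and the ranges are orthogonal. *)
Lemma rgs_shift_orth rho w n : shortlex rho w -> (word_rank w <= n)%N ->
  inner phi (mono w) (word_shift rho (g n)) = 0.
Proof.
elim: rho w => [|k rho IH] w rw wn.
  rewrite -monomE // rgs_inner_monom (rgs_orth gP) ?conjC0 // wn andbT.
  by move: rw; rewrite shortlex_rank.
case: w rw wn => [|l w] rw wn; first by rewrite /shortlex in rw.
rewrite -ncX_mono inner_mulX; case: eqP => // lk; subst l.
apply: IH; first by rewrite -(shortlex_cons k).
apply: leq_trans wn; apply: ltnW; rewrite -shortlex_rank /shortlex /=.
by rewrite ltnSn.
Qed.

(** The limits are the inner products with [X_rho omega], where [omega] is the unit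
    vector in the completion to which [g] converges. *)
Lemma rgs_shift_cvg rho : exists theta : word N -> C, forall w,
  (inner phi (mono w) (word_shift rho (g n)) : C^o) @[n --> \oo] --> (theta w : C^o).
Proof.
suff /choice[theta tP] : forall w, exists l : C,
    (inner phi (mono w) (word_shift rho (g n)) : C^o) @[n --> \oo] --> (l : C^o).
  by exists theta.
move=> w; pose L p := (inner phi (mono w) (word_shift rho p))^*.
have [|p|l Ll] := @rgs_functional_cvg L 1 ler01.
- by move=> p q; rewrite /L word_shiftB (pformBr ipP) rmorphB.
- rewrite mul1r /L norm_conjC -(ler_pXn2r (ltn0Sn 1)) ?nnegrE ?normr_ge0
    ?sqrtC_ge0 ?(pform_ge0 ipP) // sqrtCK.
  apply: le_trans (cauchy_schwarz ipP _ _) _.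
  by rewrite inner_mono1 // mul1r inner_word_shift.
exists l^*; have LE : (fun n => inner phi (mono w) (word_shift rho (g n)) : C^o) =
    (fun n => (L (g n))^* : C^o).
  by apply/funext => n; rewrite /L conjCK.
by rewrite LE; exact: cvgc_conj.
Qed.

End ReverseGramSchmidt.

(** * The spectral factor inverts the limit of the companions *)

Section SpectralFactorInverse.
Variables (R : realType) (N : nat).
Hypothesis N_gt0 : (0 < N)%N.
Local Notation C := R[i].
Local Notation mono w := (@mkmalgU (word N) C w 1).
Implicit Types (p q : ncpoly R N) (u v w rho : word N).
Variable phi : {scalar toep R N}.
Hypotheses (phi1 : phi 1 = 1) (phi_pos : strictly_positive phi).
Let ipP := inner_form phi_pos.
Variable g : nat -> ncpoly R N.
Hypothesis gP : reverse_gram_schmidt phi g.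
Hypothesis bounded_coef : forall i, exists2 B : C, 0 <= B &
  forall p : ncpoly R N, `|word_coef i p| <= B * sqrtC (inner phi p p).
Variable c : ncseries R N.
Hypothesis cP : forall w, (mcoeff w (g n) : C^o) @[n --> \oo] --> (c w : C^o).
Variable Theta : array R N.
Hypothesis ThetaP : spectral_factor (moment_kernel phi) Theta.
Local Notation b n := (word_coef 0 (g n)).

Lemma limit_lead_ge1 : 1 <= c [::].
Proof.
apply: (cvgc_ge (cP (w:=[::]))); apply: nearW => n.
by rewrite -(rgs_lead0 N_gt0 phi1 phi_pos gP); exact: (rgs_lead_le N_gt0 phi_pos gP).
Qed.

Let c0_gt0 : 0 < c [::].
Proof. exact: lt_le_trans ltr01 limit_lead_ge1. Qed.

(** Let [omega] be the limit of [g] in the completion.  The row [theta] of the inner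
    products of the words with the unit vector [X_rho omega] defines a rank-one kernel
    below the moment kernel, by the Cauchy-Schwarz inequality; it vanishes after [rho],
    and its value at [rho] is [<1, omega>], the inverse of the constant coefficient of
    [omega]. *)
Lemma spectral_diag_ge rho : (c [::])^-1 <= Theta rho rho.
Proof.
have [theta tP] := rgs_shift_cvg N_gt0 phi1 phi_pos gP bounded_coef rho.
have t_rho : theta rho = (c [::])^-1.
  apply: (cvgc_unique (tP rho)).
  have -> : (fun n => inner phi (mono rho) (word_shift rho (g n)) : C^o) =
      (fun n => (b n)^-1 : C^o).
    apply/funext => n.
    rewrite -{1}[rho]cats0 -word_shift_cat inner_word_shift.
    exact: (rgs_inner_one N_gt0 phi_pos gP).
  by apply: cvgcV; [exact: lt0r_neq0 | exact: (cP (w:=[::]))].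
have t_trig w : shortlex rho w -> theta w = 0.
  move=> rw; apply: (cvgc_unique (tP w)); apply: cvg_near_cst.
  exists (word_rank w) => // n /= wn.
  exact: (rgs_shift_orth N_gt0 phi_pos gP).
have c0 : (c [::])^-1 != 0 by rewrite invr_eq0 lt0r_neq0.
have le_tK : kernel_le (fun v w => (theta v)^* * theta w) (moment_kernel phi).
  move=> s a _; pose p := \sum_(w <- s) a w *: mono w.
  rewrite sum_rank_one -(inner_kernel phi_pos).
  suff: `|\sum_(w <- s) a w * theta w| ^+ 2 <= inner phi p p by rewrite -subr_ge0.
  have pcvg : (inner phi p (word_shift rho (g n)) : C^o) @[n --> \oo] -->
      (\sum_(w <- s) a w * theta w : C^o).
    have -> : (fun n => inner phi p (word_shift rho (g n)) : C^o) =
       (fun n => \sum_(w <- s) a w * inner phi (mono w) (word_shift rho (g n)) : C^o).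
      apply/funext => n; rewrite (pform_suml ipP); apply: eq_bigr => w _.
      exact: (pformZl ipP).
    by apply: cvgc_sum => w _; apply: cvgc_mull.
  apply: (cvgc_le (cvgc_sqr_norm pcvg)); apply: nearW => n.
  apply: le_trans (cauchy_schwarz ipP _ _) _.
  by rewrite inner_word_shift (rgs_unit gP) mulr1.
have := spectral_factor_diag_ge N_gt0 _ t_trig ThetaP le_tK.
rewrite t_rho => /(_ c0).
rewrite (ger0_norm (spectral_factor_diag ThetaP rho)) gtr0_norm ?invr_gt0 //.
by rewrite ler_pXn2r // nnegrE ?(spectral_factor_diag ThetaP) // invr_ge0 ltW.
Qed.

(** The coefficient of [X_v] in the product of [X_rho] with the series [c]. *)
Definition shift_mx (v rho : word N) : C :=
  if prefix rho v then c (drop (size rho) v) else 0.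

Lemma prefix_shortlex rho v : prefix rho v -> ~~ shortlex v rho.
Proof.
move=> /prefixP[s ->]; rewrite shortlex_rank -leqNgt.
case: s => [|k s]; first by rewrite cats0.
by apply: ltnW; rewrite -shortlex_rank /shortlex size_cat /= addnS ltnS leq_addr.
Qed.

Lemma shift_mx_trig v rho : shortlex v rho -> shift_mx v rho = 0.
Proof.
by rewrite /shift_mx; case: ifP => // /prefix_shortlex/negbTE ->.
Qed.

Lemma shift_mx_diag rho : shift_mx rho rho = c [::].
Proof. by rewrite /shift_mx prefix_refl drop_size. Qed.

Lemma shift_coef_cvg rho v :
  (mcoeff v (word_shift rho (g n)) : C^o) @[n --> \oo] --> (shift_mx v rho : C^o).
Proof.
under eq_fun do rewrite mcoeff_word_shift.
by rewrite /shift_mx; case: ifP => _; [exact: cP | exact: (@cvg_cst C^o)].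
Qed.

Let trig v u : shortlex v u -> Theta v u = 0.
Proof. by have [F To] := spectral_factor_outer ThetaP; exact: (outer_trig To). Qed.

Lemma array_eval_shift_cvg rho w :
  (array_eval Theta (word_shift rho (g n)) w : C^o) @[n --> \oo] -->
  (\sum_(0 <= i < (word_rank w).+1) shift_mx (word_at i) rho * Theta w (word_at i) : C^o).
Proof.
under eq_fun do rewrite (array_eval_lower N_gt0 _ _ trig).
by apply: cvgc_sum => i _; apply: cvgc_mulr; exact: shift_coef_cvg.
Qed.

(** The array maps the unit vector [X_rho g n] to a vector of norm at most [1], whose
    entry [rho] is the product of the constant coefficient of [g n] with the diagonal
    entry of the array.  In the limit this entry is at least [1] by
    [spectral_diag_ge], so the other entries tend to [0]. *)
Lemma array_shift_mx rho w :
  \sum_(0 <= i < (word_rank w).+1) shift_mx (word_at i) rho * Theta w (word_at i)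
  = (w == rho)%:R.
Proof.
have [F To] := spectral_factor_outer ThetaP.
pose m := maxn (word_rank w) (word_rank rho).
have bound n := array_eval_bound phi_pos (word_shift rho (g n)) m.+1 To
  (spectral_factor_le ThetaP).
set L := fun w => \sum_(0 <= i < (word_rank w).+1)
  shift_mx (word_at i) rho * Theta w (word_at i).
rewrite -/(L w).
have Lrho : L rho = c [::] * Theta rho rho.
  rewrite /L big_nat_recr //= word_rankK // big_nat big1 => [|i /andP[_ ir]].
    by rewrite add0r shift_mx_diag.
  by rewrite shift_mx_trig ?mul0r // shortlex_rank word_atK.
have L1 : 1 <= L rho.
  by rewrite Lrho -ler_pdivrMl // mulr1 spectral_diag_ge.
have sq v : (`|array_eval Theta (word_shift rho (g n)) v| ^+ 2 : C^o)
    @[n --> \oo] --> (`|L v| ^+ 2 : C^o).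
  by apply: cvgc_sqr_norm; exact: array_eval_shift_cvg.
have Lsum : \sum_(i < m.+1) `|L (word_at i)| ^+ 2 <= 1.
  have S : (\sum_(i < m.+1)
        `|array_eval Theta (word_shift rho (g n)) (word_at i)| ^+ 2 : C^o)
      @[n --> \oo] --> (\sum_(i < m.+1) `|L (word_at i)| ^+ 2 : C^o).
    by apply: cvgc_sum => i _; exact: sq.
  apply: (cvgc_le S); apply: nearW => n; apply: le_trans (bound n) _.
  by rewrite inner_word_shift (rgs_unit gP).
have rm : (word_rank rho < m.+1)%N by rewrite ltnS leq_maxr.
have wm : (word_rank w < m.+1)%N by rewrite ltnS leq_maxl.
move: Lsum; rewrite (bigD1 (Ordinal rm)) //= word_rankK //.
have Lr2 : 1 <= `|L rho| ^+ 2.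
  by rewrite (ger0_norm (le_trans ler01 L1)) exprn_ege1.
have [->|wr] := eqVneq w rho.
  move=> /(le_trans _) le1; apply/eqP; rewrite eq_le L1 andbT.
  have : `|L rho| ^+ 2 <= 1.
    by apply: le1; rewrite lerDl sumr_ge0 // => i _; rewrite exprn_ge0.
  by rewrite (ger0_norm (le_trans ler01 L1)) expr_le1 // (le_trans ler01 L1).
rewrite (bigD1 (Ordinal wm)) /=; last first.
  by rewrite -val_eqE /= (can_eq (word_rankK N_gt0)).
rewrite word_rankK // => S.
have : `|L w| ^+ 2 <= 0.
  rewrite -(lerD2l 1) addr0; apply: le_trans S; apply: lerD => //.
  by rewrite lerDl sumr_ge0 // => i _; rewrite exprn_ge0.
by rewrite real_exprn_even_le0 // normr_eq0 => /eqP.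
Qed.

(** Lower triangular matrices over an initial segment of the words: a right
    inverse is a left inverse. *)
Lemma shift_array_mx w :
  \sum_(0 <= i < (word_rank w).+1) shift_mx w (word_at i) * Theta (word_at i) [::]
  = (w == [::])%:R.
Proof.
set m := word_rank w.
pose A : 'M[C]_m.+1 := \matrix_(i, j) Theta (word_at i) (word_at j).
pose B : 'M[C]_m.+1 := \matrix_(i, j) shift_mx (word_at i) (word_at j).
have AB : A *m B = 1%:M.
  apply/matrixP => i j; rewrite !mxE.
  have := array_shift_mx (word_at j) (word_at i).
  rewrite (can_eq (word_atK N_gt0)) word_atK // => <-.
  have im : (i.+1 <= m.+1)%N by rewrite ltn_ord.
  transitivity (\sum_(0 <= t < m.+1) A i (inord t) * B (inord t) j).
    by rewrite big_mkord; apply: eq_bigr => t _; rewrite inord_val.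
  rewrite (big_cat_nat (leq0n _) im) /= [X in _ + X]big_nat [X in _ + X]big1 ?addr0.
    rewrite big_nat [RHS]big_nat; apply: eq_bigr => t /andP[_ ti].
    by rewrite !mxE inordK ?(leq_trans ti) // mulrC.
  move=> t /andP[it tm]; rewrite !mxE inordK // trig ?mul0r //.
  by rewrite shortlex_rank !word_atK.
have := mulmx1C AB => /matrixP/(_ ord_max ord0).
rewrite !mxE -val_eqE /= => E.
rewrite big_mkord -[w in RHS](word_rankK N_gt0) -/m -[[::] in RHS](word_at0 N).
rewrite (can_eq (word_atK N_gt0)) -E; apply: eq_bigr => t _.
by rewrite !mxE /= word_rankK.
Qed.

(** The words of the form [word_at i] that are prefixes of [w] are the [take i w], so
    the first column of [shift_array_mx] is a product of power series. *)
Lemma array_series_inverse : ncseries_mul (array_series Theta) c = @ncseries_one R N.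
Proof.
apply/funext => w; rewrite /ncseries_one -shift_array_mx /ncseries_mul /array_series.
pose G v : C := Theta v [::] * c (drop (size v) w).
transitivity (\sum_(i < (size w).+1) \sum_(0 <= j < (word_rank w).+1)
    if word_at j == take i w then G (word_at j) else 0).
  apply: eq_bigr => i _; rewrite -big_mkcond /=.
  under eq_bigl do rewrite -[take i w](word_rankK N_gt0) (can_eq (word_atK N_gt0)).
  have iw : (word_rank (take i w) <= word_rank w)%N.
    have : prefix (take i w) w.
      by apply/prefixP; exists (drop i w); rewrite cat_take_drop.
    by move=> /prefix_shortlex; rewrite shortlex_rank -leqNgt.
  rewrite big_nat1_eq leq0n ltnS iw word_rankK // /G size_takel //.
  by rewrite -ltnS ltn_ord.
rewrite exchange_big /=; apply: eq_bigr => j _; set v := word_at j.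
rewrite /shift_mx; case: ifPn => [vw|vw].
  have vs : (size v < (size w).+1)%N by rewrite ltnS size_prefix.
  have E : take (size v) w = v by apply/eqP; rewrite -prefixE.
  rewrite (bigD1 (Ordinal vs)) //= E eqxx big1 ?addr0 /G 1?mulrC // => i iv.
  case: eqP => // vi; case/eqP: iv; apply: val_inj.
  by rewrite /= vi size_takel // -ltnS ltn_ord.
rewrite mul0r big1 // => i _; case: eqP => // vE.
by case/negP: vw; apply/prefixP; exists (drop i w); rewrite vE cat_take_drop.
Qed.

End SpectralFactorInverse.

(** * Inversion of formal power series *)

Section NCSeries.
Variables (R : realType) (n : nat).
Local Notation C := R[i].
Implicit Types (f g h : ncseries R n) (v w : word n).
Local Notation one := (@ncseries_one R n).

Lemma ncseries_mulA f g h :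
  ncseries_mul (ncseries_mul f g) h = ncseries_mul f (ncseries_mul g h).
Proof.
apply/funext => w; rewrite /ncseries_mul; set m := size w.
pose T j i := f (take j w) * (g (drop j (take i w)) * h (drop i w)).
transitivity (\sum_(0 <= i < m.+1) \sum_(0 <= j < m.+1 | (j < i.+1)%N) T j i).
  rewrite big_mkord; apply: eq_bigr => i _; rewrite mulr_suml.
  have im : (i <= m)%N by rewrite -ltnS ltn_ord.
  rewrite -(big_nat_widen 0 i.+1 m.+1 xpredT) ?ltn_ord // size_takel //.
  rewrite big_mkord; apply: eq_bigr => j _; rewrite /T -mulrA.
  by rewrite take_takel // -ltnS ltn_ord.
rewrite (exchange_big_dep_nat xpredT) //= big_mkord; apply: eq_bigr => j _.
have jm : (j <= m)%N by rewrite -ltnS ltn_ord.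
transitivity (\sum_(j <= i < m.+1) T j i).
  by rewrite (big_nat_widenl j 0).
rewrite mulr_sumr -{1}[j : nat]add0n big_addn.
rewrite size_drop -subSn // big_mkord; apply: eq_bigr => i _.
rewrite /T drop_drop; congr (_ * (g _ * _)).
by rewrite take_drop.
Qed.

Lemma ncseries_mul1 f : ncseries_mul one f = f.
Proof.
apply/funext => w; rewrite /ncseries_mul big_ord_recl /= take0 drop0 mul1r.
rewrite big1 ?addr0 // => i _; rewrite /ncseries_one.
case: w i => [|k w] i; first by case: i.
by rewrite /= mul0r.
Qed.

Lemma ncseries_1mul f : ncseries_mul f one = f.
Proof.
apply/funext => w; rewrite /ncseries_mul big_ord_recr /= take_size drop_size mulr1.
rewrite big1 ?add0r // => i _; rewrite /ncseries_one -size_eq0 size_drop.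
by rewrite subn_eq0 leqNgt ltn_ord mulr0.
Qed.

(** The coefficients of a left inverse are determined by induction on the
    length of the word. *)
Lemma ncseries_left_invE h f w : ncseries_mul h f = one -> f [::] != 0 ->
  h w = (one w - \sum_(i < size w) h (take i w) * f (drop i w)) / f [::].
Proof.
move=> /(congr1 (fun s => s w)) <- f0; rewrite /ncseries_mul big_ord_recr /=.
by rewrite take_size drop_size [X in X - _]addrC addrK mulfK.
Qed.

(** The recursion of [ncseries_left_invE], which calls itself on proper prefixes; the
    fuel [m] bounds the length of the words treated. *)
Fixpoint left_inv_upto f m w : C :=
  if m is m'.+1 then
    (one w - \sum_(i < size w) left_inv_upto f m' (take i w) * f (drop i w)) / f [::]
  else 0.

Lemma left_inv_uptoE f m m' w : (size w < m)%N -> (size w < m')%N ->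
  left_inv_upto f m w = left_inv_upto f m' w.
Proof.
elim: m m' w => [|m IH] [|m'] w //=; rewrite !ltnS => wm wm'.
congr ((_ - _) / _); apply: eq_bigr => i _; congr (_ * _).
have iw : size (take i w) = i by rewrite size_takel // ltnW.
by apply: IH; rewrite iw; apply: leq_trans (ltn_ord i) _.
Qed.

Lemma ncseries_left_inv f : f [::] != 0 -> exists h, ncseries_mul h f = one.
Proof.
move=> f0; pose h w := left_inv_upto f (size w).+1 w.
have hE w : h w = (one w - \sum_(i < size w) h (take i w) * f (drop i w)) / f [::].
  rewrite {1}/h [LHS]/=; congr ((_ - _) / _); apply: eq_bigr => i _; congr (_ * _).
  have iw : size (take i w) = i by rewrite size_takel // ltnW.
  by apply: left_inv_uptoE; rewrite iw.
exists h; apply/funext => w; rewrite /ncseries_mul big_ord_recr take_size drop_size.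
by rewrite /= (hE w) divfK // addrC subrK.
Qed.

(** A left inverse has itself a left inverse, which by associativity is [f]: left
    inverses are two-sided. *)
Lemma ncseries_mul_inv f : f [::] != 0 -> ncseries_mul (ncseries_inv f) f = one.
Proof.
move=> f0; have [h hf] := ncseries_left_inv f0.
have h0 : h [::] != 0.
  have := congr1 (fun s => s [::]) hf.
  rewrite /ncseries_mul big_ord1 /ncseries_one eqxx => E.
  by apply/eqP => h00; move: E; rewrite /= h00 mul0r => /eqP; rewrite eq_sym oner_eq0.
have [h' h'h] := ncseries_left_inv h0.
have fh : ncseries_mul f h = one.
  have -> : f = h' by rewrite -[LHS]ncseries_mul1 -h'h ncseries_mulA hf ncseries_1mul.
  exact: h'h.
rewrite /ncseries_inv.
pose inverses : set (ncseries R n) :=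
  [set g | ncseries_mul f g = one /\ ncseries_mul g f = one].
by case: (@xgetPex _ (fun=> 0) inverses); first by exists h.
Qed.

(** Inversion is continuous for coefficientwise convergence, by induction on the length
    of the word, since the inverse is computed coefficient by coefficient. *)
Lemma ncseries_inv_cvg (p : nat -> ncseries R n) (c theta : ncseries R n) :
  (forall m, p m [::] != 0) -> c [::] != 0 ->
  (forall w, (p m w : C^o) @[m --> \oo] --> (c w : C^o)) ->
  ncseries_mul theta c = one ->
  forall w, (ncseries_inv (p m) w : C^o) @[m --> \oo] --> (theta w : C^o).
Proof.
move=> p0 c0 pc tc w; have [l] := ubnP (size w).
elim: l w => // l IH w; rewrite ltnS => wl.
rewrite (ncseries_left_invE w tc c0).
have -> : (fun m => ncseries_inv (p m) w : C^o) = (fun m =>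
    (one w - \sum_(i < size w) ncseries_inv (p m) (take i w) * p m (drop i w))
    / p m [::] : C^o).
  by apply/funext => m; apply: ncseries_left_invE => //; exact: ncseries_mul_inv.
apply: cvgcM; last exact: cvgcV.
apply: cvgcB; first exact: (@cvg_cst C^o).
apply: cvgc_sum => i _; apply: cvgcM; last exact: pc.
apply: IH; apply: leq_trans wl.
by rewrite size_takel // ltnW.
Qed.

End NCSeries.

(** * Proof of the theorem *)

Lemma cvg_word_infty (R : realType) (N : nat) (u : nat -> R[i]) (l : R[i]) :
  (0 < N)%N ->
  (u n : R[i]^o) @[n --> \oo] --> (l : R[i]^o) ->
  (u (word_rank (v : word N)) : R[i]^o) @[v --> word_infty] --> (l : R[i]^o).
Proof.
move=> N_gt0 ul; apply: (cvg_comp (word_rank : word N -> nat) _ _ ul).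
move=> A [m _ mA]; exists m => // w /= mw; apply: mA; apply: leq_trans mw _.
rewrite -{1}(word_rankK N_gt0 w) -mem_words_upto mem_nth //.
exact: size_words_upto.
Qed.

Theorem theorem4p1 (R : realType) (N : nat) (N_ge1 : (1 <= N)%N)
    (phi : {scalar toep R N})
    (phi_unital : phi 1 = 1)
    (phi_pos : strictly_positive phi)
    (phi_szego : szego_class phi)
    (gamma : nat -> nat -> R[i])
    (gammaP : schur_params (word_kernel (moment_kernel phi)) gamma)
    (f fs : word N -> ncpoly R N)
    (fP : gram_schmidt phi f)
    (fsP : companion gamma f fs)
    (Theta : array R N)
    (ThetaP : spectral_factor (moment_kernel phi) Theta) :
  coeffwise_cvg (fun w => ncseries_of_poly (f w)) (fun=> 0) /\
  coeffwise_cvg (fun w => ncseries_inv (ncseries_of_poly (fs w)))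
    (array_series Theta).
Proof.
have [Theta' [ [F' To'] TK' _ _] T0'] := phi_szego.
have bounded i : exists2 B : R[i], 0 <= B &
    forall p : ncpoly R N, `|word_coef i p| <= B * sqrtC (inner phi p p).
  have [B B0 Bp] := coef_bound N_ge1 phi_pos i.+1 To' TK' T0'.
  by exists B => // p; apply: Bp.
split=> w.
  have [B B0 Bp] := bounded (word_rank w).
  have := cvg_word_infty N_ge1 (orthonormal_coef_cvg0 N_ge1 phi_pos fP Bp B0).
  have -> // : (fun v => word_coef (word_rank w) (f (word_at (word_rank v))) : R[i]^o) =
      (fun v => ncseries_of_poly (f v) w : R[i]^o).
  by apply/funext => v; rewrite word_coefE // word_rankK.
pose g n := (szego monom gamma n 0).2 : ncpoly R N.
have sP := szego_monomP N_ge1 phi_unital phi_pos gammaP.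
have gP : reverse_gram_schmidt phi g.
  by split=> n; case: (sP n 0%N).
have [c cP] := rgs_coef_cvg N_ge1 phi_unital phi_pos gP bounded.
have c1 := limit_lead_ge1 N_ge1 phi_unital phi_pos gP cP.
have Tc := array_series_inverse N_ge1 phi_unital phi_pos gP bounded cP ThetaP.
have g0 n : ncseries_of_poly (g n) [::] != 0 by exact: lt0r_neq0 (rgs_lead gP n).
have c0 : c [::] != 0 by rewrite lt0r_neq0 // (lt_le_trans ltr01).
have := cvg_word_infty N_ge1 
  (@ncseries_inv_cvg R N (fun n => ncseries_of_poly (g n)) c _ g0 c0 cP Tc w).
have -> // : (fun v => ncseries_inv (ncseries_of_poly (g (word_rank v))) w : R[i]^o) =
    (fun v => ncseries_inv (ncseries_of_poly (fs v)) w : R[i]^o).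
apply/funext => v.
by rewrite (companion_szego N_ge1 phi_unital phi_pos fP gammaP fsP).
Qed.
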